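(* The $CAT(0)$ cubical complex $X$ contains flats of any dimension: for every integer $m\ge1$ there is an isometric embedding of the Euclidean space $\mathbb{R}^m$ into $X$.
   Context: Thompson-like functions. For an integer $n\ge 1$ let $F_n$ be the set of piecewise linear homeomorphisms $g:[0,1]\to[0,n]$ with finitely many breaking points, all at dyadic rationals, and all slopes (integer) powers of $2$ (so $g$ is increasing). $F_\infty=\bigcup_{n\ge1}F_n$. Put $[n]=\{1,\dots,n\}$. For $J\subseteq[n]$ let $s_{n,J}:[0,n]\to[0,n+|J|]$ be the increasing piecewise linear bijection with slope $2$ on $[j-1,j]$ for $j\in J$ and slope $1$ on the other intervals $[j-1,j]$. For $g\in F_n$ put $g[J]=s_{n,J}\circ g\in F_{n+|J|}$. The complex $X$. For $g\in F_n$ let $C(g)$ be an $n$-dimensional unit cube $[0,1]^n$ whose vertex $\chi_J$ (the characteristic vector of $J\subseteq[n]$) is labeled by $g[J]$. $X$ is the cubical complex obtained by gluing the cubes $C(g)$, $g\in F_\infty$, along faces with the same labels; its vertex set is $F_\infty$. It carries the length metric $d$ for which every cube is a Euclidean unit cube; with it $X$ is a $CAT(0)$ space. *)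

(* Defs.v *)
From HB Require Import structures.
From mathcomp Require Import all_boot all_order all_algebra.
From mathcomp Require Import all_classical all_reals all_analysis.
From mathcomp Require Import ring.
From Stdlib Require Import Relation_Operators.

Set Implicit Arguments.
Unset Strict Implicit.
Unset Printing Implicit Defensive.
Import Order.TTheory GRing.Theory Num.Theory numFieldNormedType.Exports.
Local Open Scope classical_set_scope.
Local Open Scope ring_scope.
Local Open Scope quotient_scope.

Section Thompson.
Variable R : realType.
Implicit Types (g : R -> R) (n : nat).

Definition dyadic (x : R) : Prop :=
  exists (a : int) (k : nat), x = a%:~R / 2 ^+ k.

Definition homeomorphism_on (A B : set R) (f : R -> R) : Prop :=
  exists h : R -> R,
    [/\ set_fun A B f, set_fun B A h, {in A, cancel f h}, {in B, cancel h f}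
      & {within A, continuous f} /\ {within B, continuous h}].

(* Entries of s that are not actual breaking points are harmless: breaking
   points that are dyadic can always be refined by further dyadic points. *)
Definition dyadic_piecewise_linear g : Prop :=
  exists s : seq R,
    [/\ {in s, forall t, dyadic t}, path <%R 0 s, last 0 s = 1
      & forall i, (i < size s)%N -> exists (k : int) (c : R),
          forall x, x \in `[nth 0 (0 :: s) i, nth 0 (0 :: s) i.+1] ->
            g x = 2 ^ k * x + c].

(* A function on [0, 1] is encoded as a total function R -> R vanishing outside
   [0, 1], so that Leibniz equality is equality of functions on [0, 1]. *)
Definition thompson n g : Prop :=
  [/\ forall x, x \notin `[0, 1] -> g x = 0,
      homeomorphism_on `[0, 1] `[0, n%:R] g
    & dyadic_piecewise_linear g].

(* s_{n,J}: the summand of j increases with slope 1 on [j, j + 1] and is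
   constant elsewhere. Indices of 'I_n start at 0, so that j : 'I_n stands for
   the interval [j, j + 1]. *)
Definition split_map n (J : {set 'I_n}) (x : R) : R :=
  x + \sum_(j in J) Num.min 1 (Num.max 0 (x - j%:R)).

Lemma split_map_slope n (J : {set 'I_n}) (i : 'I_n) (x : R) :
  i%:R <= x <= i.+1%:R ->
  split_map J x = split_map J i%:R + (if i \in J then 2 else 1) * (x - i%:R).
Proof.
move=> /andP[ix xi]; rewrite /split_map.
pose c (y : R) (j : 'I_n) : R := Num.min 1 (Num.max 0 (y - j%:R)).
have cP j : c x j = c i%:R j + (j == i)%:R * (x - i%:R).
  rewrite /c; have [->|/eqP/val_eqP/= ji] := eqVneq j i.
    rewrite subrr mul1r maxxx max_r ?subr_ge0// !min_r ?add0r//.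
    by rewrite lerBlDr -natr1 addrC in xi *.
  rewrite mul0r addr0; case: (ltngtP j i) ji => // [ji|ij] _.
    have h : 1 <= (i%:R : R) - j%:R by rewrite lerBrDr nat1r ler_nat.
    have h' : 1 <= x - j%:R by apply: le_trans h _; rewrite lerB.
    by rewrite !max_r ?(le_trans ler01)// !min_l.
  have h' : x - j%:R <= 0.
    by rewrite subr_le0; apply: le_trans xi _; rewrite ler_nat.
  have h : (i%:R : R) - j%:R <= 0 by rewrite subr_le0 ler_nat ltnW.
  by rewrite !max_l.
have key (S S' : R) : S = S' + (i \in J)%:R * (x - i%:R) ->
    x + S = i%:R + S' + (if i \in J then 2 else 1) * (x - i%:R).
  by move=> ->; case: (i \in J) => /=; ring.
apply: key; rewrite (eq_bigr _ (fun j _ => cP j)) big_split /=; congr (_ + _).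
have [iJ|iJ] := boolP (i \in J).
  rewrite (bigD1 i)//= eqxx big1 ?addr0// => j /andP[_ /negbTE ->].
  by rewrite mul0r.
rewrite mul0r big1// => j jJ; case: eqVneq jJ iJ => [->->//|_ _ _].
by rewrite mul0r.
Qed.

(* This is g[J]; it still vanishes outside [0, 1] because split_map J 0 = 0. *)
Definition split_label n g (J : {set 'I_n}) : R -> R := split_map J \o g.

Definition enorm n (u : 'rV[R]_n) : R := Num.sqrt (\sum_i u 0 i ^+ 2).

Definition chi n (J : {set 'I_n}) : 'rV[R]_n := \row_i (i \in J)%:R.

(* For A \subset B, the face of the unit cube whose vertices are the chi J with
   A \subset J \subset B; every face is of this form. *)
Definition face n (A B : {set 'I_n}) : set 'rV[R]_n :=
  [set x : 'rV[R]_n | forall i, [/\ 0 <= x 0 i <= 1, i \in A -> x 0 i = 1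
                                      & i \notin B -> x 0 i = 0]].

(* A point of the disjoint union of the cubes C(g), g in F_oo. *)
Record cube_point := CubePoint {
  cdim : nat;
  clabel : R -> R;
  cpos : 'rV[R]_cdim;
  cdim_gt0 : (0 < cdim)%N;
  clabelP : thompson cdim clabel;
  cposP : forall i, 0 <= cpos 0 i <= 1 }.

HB.instance Definition _ := gen_eqMixin cube_point.
HB.instance Definition _ := gen_choiceMixin cube_point.

(* p and q lie on faces of their cubes carrying the same vertex labels, and q is
   the image of p under the affine identification u |-> u *m M + b of these
   faces that preserves the labels of the vertices. *)
Definition glued (p q : cube_point) : Prop :=
  exists (A B : {set 'I_(cdim p)}) (A' B' : {set 'I_(cdim q)})
         (M : 'M[R]_(cdim p, cdim q)) (b : 'rV[R]_(cdim q)),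
    [/\ A \subset B /\ A' \subset B',
        forall J : {set 'I_(cdim p)}, A \subset J /\ J \subset B ->
          exists J' : {set 'I_(cdim q)}, [/\ A' \subset J' /\ J' \subset B',
            chi J *m M + b = chi J'
          & split_label (clabel p) J = split_label (clabel q) J'],
        forall J' : {set 'I_(cdim q)}, A' \subset J' /\ J' \subset B' ->
          exists J : {set 'I_(cdim p)}, [/\ A \subset J /\ J \subset B,
            chi J *m M + b = chi J'
          & split_label (clabel p) J = split_label (clabel q) J'],
        face A B (cpos p)
      & cpos q = cpos p *m M + b].

Definition glue_rel (p q : cube_point) : bool :=
  `[< clos_refl_sym_trans _ glued p q >].

Lemma glue_rel_refl : reflexive glue_rel.
Proof. by move=> p; apply/asboolP/rst_refl. Qed.

Lemma glue_rel_sym : symmetric glue_rel.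
Proof. by move=> p q; apply/asboolP/asboolP; apply: rst_sym. Qed.

Lemma glue_rel_trans : transitive glue_rel.
Proof.
move=> q p r /asboolP pq /asboolP qr; apply/asboolP.
exact: rst_trans pq qr.
Qed.

Canonical glue_equiv := EquivRel glue_rel glue_rel_refl glue_rel_sym glue_rel_trans.

Definition X : Type := {eq_quot glue_equiv}.

Definition to_X (p : cube_point) : X := \pi_({eq_quot glue_equiv}) p.

(* P and Q lie in a common cube, where they are at Euclidean distance l. *)
Definition cube_dist (P Q : X) (l : R) : Prop :=
  exists n g (n_gt0 : (0 < n)%N) (Fg : thompson n g) (x y : 'rV[R]_n)
    (x01 : forall i, 0 <= x 0 i <= 1) (y01 : forall i, 0 <= y 0 i <= 1),
    [/\ P = to_X (CubePoint n_gt0 Fg x01), Q = to_X (CubePoint n_gt0 Fg y01)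
      & l = enorm (x - y)].

(* The intrinsic (length) metric of a Euclidean polyhedral complex: the infimum
   of the lengths of the strings from P to Q, that is, of the polygonal chains
   whose successive points lie in a common cube (+oo if there is none). *)
Definition dX (P Q : X) : \bar R :=
  ereal_inf [set L | exists (k : nat) (z : nat -> X) (l : nat -> R),
    [/\ z 0%N = P, z k = Q,
        forall i, (i < k)%N -> cube_dist (z i) (z i.+1) (l i)
      & L = (\sum_(i < k) l i)%:E]].

End Thompson.

(* Main.v *)
Require Import Defs.
From mathcomp Require Import all_boot all_order all_algebra.
From mathcomp Require Import all_classical all_reals all_analysis.
From mathcomp Require Import perm ring lra zify.
From Stdlib Require Import Relation_Operators.

(** A one-dimensional flat is the axis of the generator rho of Thompson's group
    F acting on X by composition on the right: the vertices
    v_k = 2 rho^{-k} in F_2 satisfy v_k[{2}] = v_{k+1}[{1}], so the diagonals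
    of the squares C(v_k), joined end to end, form a line.  Subdividing [0, 1]
    into N = 2^r blocks and using an independent integer exponent in each block
    gives the flat, a union of cubes of diagonals inside the cubes C(V_k),
    where k : 'I_N -> int and V_k is in F_{2N}.

    The distances are bounded above by following a segment of the flat from
    cell to cell.  For the lower bound, a hyperplane of X is a dyadic map
    psi : [0, 1] -> [0, 1]: an edge from g to g[{j}] crosses it when psi is the
    inverse of the j-th piece of g.  The hyperplanes that meet the flat fall
    into 2N families (two for each block), and the pieces of one vertex label
    contain at most one member of each family, since all members of a family
    share an endpoint.  Summing over each family the affine "height" above a
    hyperplane therefore gives a 1-Lipschitz map from X to R^{2N}, and this map
    is isometric on the flat. *)

Set Implicit Arguments.
Unset Strict Implicit.
Unset Printing Implicit Defensive.
Import Order.TTheory GRing.Theory Num.Theory numFieldNormedType.Exports.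
Local Open Scope ring_scope.
Local Open Scope quotient_scope.

(** * The generator rho of Thompson's group *)

Section Rho.
Variable R : realType.
Implicit Types (x y t : R) (k l : int) (d : nat).

(** The standard generator of F, continued affinely to all of R. It is concave, hence the minimum of
    its branches, and its inverse is the maximum of the inverse branches; on R they cancel without a
    domain condition. *)
Definition rho x : R := Num.min (2 * x) (Num.min (x + 4^-1) ((x + 1) / 2)).
Definition rho_inv x : R := Num.max (x / 2) (Num.max (x - 4^-1) (2 * x - 1)).

Variant rho_spec x : R -> Type :=
| RhoLeft of x <= 4^-1 : rho_spec x (2 * x)
| RhoMid of 4^-1 <= x <= 2^-1 : rho_spec x (x + 4^-1)
| RhoRight of 2^-1 <= x : rho_spec x ((x + 1) / 2).

Lemma rhoP x : rho_spec x (rho x).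
Proof.
rewrite /rho; case: (leP x 4^-1) => h1.
  by rewrite min_l; [exact: RhoLeft|rewrite le_min; apply/andP; split; lra].
rewrite min_r; last by rewrite ge_min; apply/orP; left; lra.
case: (leP x 2^-1) => h2.
  by rewrite min_l; [apply: RhoMid; rewrite h2 ltW|lra].
by rewrite min_r; [apply: RhoRight; rewrite ltW|lra].
Qed.

Variant rho_inv_spec x : R -> Type :=
| RhoInvLeft of x <= 2^-1 : rho_inv_spec x (x / 2)
| RhoInvMid of 2^-1 <= x <= 3 / 4 : rho_inv_spec x (x - 4^-1)
| RhoInvRight of 3 / 4 <= x : rho_inv_spec x (2 * x - 1).

Lemma rho_invP x : rho_inv_spec x (rho_inv x).
Proof.
rewrite /rho_inv; case: (leP x 2^-1) => h1.
  by rewrite max_l; [exact: RhoInvLeft|rewrite ge_max; apply/andP; split; lra].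
rewrite max_r; last by rewrite le_max; apply/orP; left; lra.
case: (leP x (3 / 4)) => h2.
  by rewrite max_l; [apply: RhoInvMid; rewrite h2 ltW|lra].
by rewrite max_r; [apply: RhoInvRight; rewrite ltW|lra].
Qed.

Lemma rhoK : cancel rho rho_inv.
Proof. by move=> x; case: rhoP => ?; case: rho_invP => ?; lra. Qed.

Lemma rho_invK : cancel rho_inv rho.
Proof. by move=> x; case: rho_invP => ?; case: rhoP => ?; lra. Qed.

Definition rho_pow (k : int) : R -> R :=
  match k with Posz d => iter d rho | Negz d => iter d.+1 rho_inv end.

Lemma rho_powS k x : rho_pow (k + 1) x = rho (rho_pow k x).
Proof.
case: k => [d|[|d]]; first by rewrite -PoszD addn1.
  by rewrite /= rho_invK.
have -> : Negz d.+1 + 1 = Negz d by lia.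
by rewrite [in RHS]/= rho_invK.
Qed.

Lemma rho_powB1 k x : rho_pow (k - 1) x = rho_inv (rho_pow k x).
Proof. by rewrite -{2}(subrK 1 k) rho_powS rhoK. Qed.

Lemma rho_powD k l x : rho_pow (k + l) x = rho_pow k (rho_pow l x).
Proof.
elim: k => [|d IH|d IH]; first by rewrite add0r.
  by rewrite -addn1 PoszD -addrA (addrC 1) addrA rho_powS IH rho_powS.
by rewrite -addn1 PoszD opprD -addrA (addrC (-1)) addrA rho_powB1 IH rho_powB1.
Qed.

Lemma rho_powK k : cancel (rho_pow k) (rho_pow (- k)).
Proof. by move=> x; rewrite -rho_powD addNr. Qed.

Lemma rho_pow0 k : rho_pow k 0 = 0.
Proof.
elim: k => [//|d IH|d IH].
  by rewrite -addn1 PoszD rho_powS IH; case: rhoP => ?; lra.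
by rewrite -addn1 PoszD opprD rho_powB1 IH; case: rho_invP => ?; lra.
Qed.

Lemma rho_pow1 k : rho_pow k 1 = 1.
Proof.
elim: k => [//|d IH|d IH].
  by rewrite -addn1 PoszD rho_powS IH; case: rhoP => ?; lra.
by rewrite -addn1 PoszD opprD rho_powB1 IH; case: rho_invP => ?; lra.
Qed.

Lemma ler_rho_inv x y : x <= y -> rho_inv x <= rho_inv y.
Proof.
by move=> xy; do 2![case: rho_invP => ?]; lra.
Qed.

Lemma ler_rho x y : x <= y -> rho x <= rho y.
Proof.
by move=> xy; do 2![case: rhoP => ?]; lra.
Qed.

Lemma rho_pow_homo k : {homo rho_pow k : x y / x <= y}.
Proof.
move=> x y xy; elim: k => [//|d IH|d IH].
  by rewrite -addn1 PoszD !rho_powS ler_rho.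
by rewrite -addn1 PoszD opprD !rho_powB1 ler_rho_inv.
Qed.

Lemma rho_pow_mono k : {mono rho_pow k : x y / x <= y}.
Proof.
move=> x y; apply/idP/idP; last exact: rho_pow_homo.
by move/(rho_pow_homo (- k)); rewrite !rho_powK.
Qed.

Lemma rho_pow01 k x : 0 <= x <= 1 -> 0 <= rho_pow k x <= 1.
Proof. by rewrite -{2}(rho_pow0 k) -{2}(rho_pow1 k) !rho_pow_mono. Qed.

(** Above 1/2 the orbit stays on the branch $(x+1)/2$, which keeps it there. *)
Lemma rho_pow_half_gt d : 1 / 2 < rho_pow d.+1 (1 / 2).
Proof.
elim: d => [|d IH].
  by rewrite /=; case: rhoP => ?; lra.
have -> : Posz d.+2 = Posz d.+1 + 1 by lia.
have half01 : 0 <= (1 / 2 : R) <= 1 by lra.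
have /andP[_ u] := rho_pow01 d.+1 half01.
rewrite rho_powS.
by move: IH u; case: rhoP => ?; lra.
Qed.

(** The orbit of 1/2 orders the exponents; this later tells the hyperplanes of one family apart. *)
Lemma rho_pow_half_mono k l : (rho_pow k (1 / 2) <= rho_pow l (1 / 2)) = (k <= l).
Proof.
have H (a b : int) : a < b -> rho_pow a (1 / 2) < rho_pow b (1 / 2).
  move=> ab; have -> : b = a + (absz (b - a)).-1.+1 by lia.
  by rewrite rho_powD (leW_mono (rho_pow_mono a)) rho_pow_half_gt.
by case: (ltgtP k l) => [/H/ltW->//|/H|-> //]; rewrite ?lexx // ltNge => /negbTE.
Qed.

Lemma rho_pow_half_itv k : 0 < rho_pow k (1 / 2) < 1.
Proof.
have := leW_mono (rho_pow_mono k) 0 (1 / 2).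
have := leW_mono (rho_pow_mono k) (1 / 2) 1.
by rewrite rho_pow0 rho_pow1 => -> ->; lra.
Qed.

(** On [0, 1/2] [rho_inv] is division by 2; likewise [rho] halves the distance to 1 on [1/2, 1]. The
    resulting formulas are used in [flat_label_below]. *)
Lemma rho_pow_left d t : 0 <= t <= 1 ->
  rho_pow (- d%:Z) (t / 2) = t / 2 ^+ d.+1.
Proof.
move=> t01; elim: d => [|d IH]; first by rewrite oppr0 expr1.
rewrite -addn1 PoszD opprD rho_powB1 IH.
have : 0 <= t / 2 ^+ d.+1 <= 1 / 2.
  rewrite divr_ge0 ?exprn_ge0//=; last lra.
  rewrite ler_pdivrMr ?exprn_gt0// exprS.
  have : 1 <= 2 ^+ d :> R by rewrite exprn_ege1 // ler1n.
  nra.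
rewrite addn1 (exprSr _ d.+1) invfM mulrA; set z := t / _ => z01.
by case: rho_invP => ?; lra.
Qed.

Lemma rho_pow_right d t : 0 <= t <= 1 ->
  rho_pow d (1 - t / 2) = 1 - t / 2 ^+ d.+1.
Proof.
move=> t01; elim: d => [|d IH]; first by rewrite expr1.
rewrite -addn1 PoszD rho_powS IH.
have : 0 <= t / 2 ^+ d.+1 <= 1 / 2.
  rewrite divr_ge0 ?exprn_ge0//=; last lra.
  rewrite ler_pdivrMr ?exprn_gt0// exprS.
  have : 1 <= 2 ^+ d :> R by rewrite exprn_ege1 // ler1n.
  nra.
rewrite addn1 (exprSr _ d.+1) invfM mulrA; set z := t / _ => z01.
by case: rhoP => ?; lra.
Qed.

End Rho.

(** * Dyadic piecewise linear functions *)

Section PL.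
Local Open Scope classical_set_scope.
Local Open Scope ring_scope.
Variable R : realType.
Implicit Types (a b c x y : R) (f g : R -> R).

Lemma dyadic_int (z : int) : dyadic (z%:~R : R).
Proof. by exists z, 0%N; rewrite expr0 divr1. Qed.

Lemma dyadicD a b : dyadic a -> dyadic b -> dyadic (a + b).
Proof.
move=> [p [k ->]] [q [l ->]]; exists (p * 2 ^+ l + q * 2 ^+ k), (k + l)%N.
rewrite rmorphD /= !rmorphM /= !rmorphXn /= exprD.
by field; rewrite !expf_neq0 ?pnatr_eq0.
Qed.

Lemma dyadicN a : dyadic a -> dyadic (- a).
Proof. by move=> [p [k ->]]; exists (- p), k; rewrite rmorphN mulNr. Qed.

Lemma dyadicZ (k : int) a : dyadic a -> dyadic (2 ^ k * a).
Proof.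
move=> [p [l ->]]; case: k => k.
  by exists (2 ^+ k * p), l; rewrite rmorphM /= rmorphXn /= mulrA.
exists p, (k.+1 + l)%N; rewrite NegzE -exprnN exprD invfM; ring.
Qed.

(** Adjacent closed pieces share an endpoint, so continuity is built in. This form, unlike a list of
    breaking points, concatenates, splits and composes by induction. *)
Inductive pl (g : R -> R) : R -> R -> Prop :=
| pl_nil a of dyadic a : pl g a a
| pl_cons a b c (k : int) of dyadic a & a < b &
    (forall x, a <= x <= b -> g x = g a + 2 ^ k * (x - a)) & pl g b c : pl g a c.

Lemma exp2_gt0 (k : int) : 0 < 2 ^ k :> R.
Proof. exact: exprz_gt0. Qed.

Lemma pl_dyadic g a b : pl g a b -> dyadic a /\ dyadic b.
Proof. by elim=> [c ?//|{}a c {}b k da _ _ _ [_ ?]]. Qed.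

Lemma pl_le g a b : pl g a b -> a <= b.
Proof. by elim=> [c _//|{}a c {}b k _ ac _ _ cb]; apply/ltW/lt_le_trans/cb. Qed.

Lemma pl_cat g a b c : pl g a b -> pl g b c -> pl g a c.
Proof.
elim=> [//|{}a d {}b k da ad gad _ IH] /IH; exact: pl_cons ad gad.
Qed.

Lemma eq_pl f g a b :
  (forall x, a <= x <= b -> f x = g x) -> pl f a b -> pl g a b.
Proof.
move=> fg h; elim: h fg => [c dc _|{}a c {}b k da ac fac cb IH fg].
  exact: pl_nil.
have cb' := pl_le cb.
apply: (pl_cons da ac) => [x /andP[ax xc]|].
  rewrite -!fg ?ax ?lexx ?(le_trans xc)// ?(le_trans (ltW ac))//.
  by apply: fac; rewrite ax.
by apply: IH => x /andP[cx xb]; apply: fg; rewrite xb (le_trans (ltW ac)).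
Qed.

Lemma pl_affine g a b (k : int) : dyadic a -> dyadic b -> a <= b ->
  (forall x, a <= x <= b -> g x = g a + 2 ^ k * (x - a)) -> pl g a b.
Proof.
move=> da db; rewrite le_eqVlt => /predU1P[<- _|ab gab]; first exact: pl_nil.
exact: pl_cons da ab gab (pl_nil _ db).
Qed.

Lemma pl_split g a b c : dyadic b -> a <= b <= c -> pl g a c ->
  pl g a b /\ pl g b c.
Proof.
move=> db abc h; elim: h abc => [d dd|{}a d {}c k da ad gad dc IH].
  by move=> /le_anti <-; split; exact: pl_nil.
move=> /andP[ab bc]; case: (leP b d) => [bd|db'].
  split; first by apply: (pl_affine (k := k)) => // x /andP[ax xb];
    apply: gad; rewrite ax (le_trans xb).
  have [dd _] := pl_dyadic dc; apply: pl_cat dc.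
  apply: (pl_affine (k := k)) => // x /andP[bx xd].
  by rewrite [g x]gad ?[g b]gad ?ab ?bd ?xd ?(le_trans ab)//; ring.
have [|bd bc'] := IH; first by rewrite (ltW db').
by split=> //; exact: pl_cons da ad gad bd.
Qed.

Lemma pl_lt g a b : pl g a b -> forall x y, a <= x -> x < y -> y <= b -> g x < g y.
Proof.
elim=> [c dc x y cx xy yc|{}a c {}b k da ac gac cb IH x y ax xy yb].
  by have := le_lt_trans cx (lt_le_trans xy yc); rewrite ltxx.
have P := exp2_gt0 k.
have H x' y' : a <= x' -> x' < y' -> y' <= c -> g x' < g y'.
  move=> h1 h2 h3; rewrite [g x']gac ?[g y']gac ?h1 ?h3 ?(le_trans (ltW h2))//.
    by rewrite ltrD2l ltr_pM2l// ltrD2r.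
  by rewrite (le_trans h1 (ltW h2)).
case: (leP y c) => yc; first exact: H.
case: (leP c x) => cx; first exact: IH.
by apply: lt_trans (H _ _ ax cx (lexx _)) (IH _ _ (lexx _) yc yb).
Qed.

Lemma pl_surj g a b : pl g a b -> forall y, g a <= y <= g b ->
  exists2 x, a <= x <= b & g x = y.
Proof.
elim=> [c dc y /le_anti <-|{}a c {}b k da ac gac cb IH y /andP[ay yb]].
  by exists c; rewrite ?lexx.
have P := exp2_gt0 k; have cb' := pl_le cb.
case: (leP y (g c)) => yc; last first.
  have [|x /andP[cx xb] <-] := IH y; first by rewrite ltW.
  by exists x; rewrite ?xb ?(le_trans (ltW ac)).
pose x := a + (y - g a) / 2 ^ k; have xP : 2 ^ k * (x - a) = y - g a.
  by rewrite /x addrAC subrr add0r mulrCA divff ?mulr1// lt0r_neq0.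
have ax : a <= x by rewrite lerDl divr_ge0 ?subr_ge0// ltW.
have xc : x <= c.
  move: yc; rewrite [g c]gac ?lexx ?(ltW ac)// -lerBlDl -xP ler_pM2l// lerD2r //.
exists x; first by rewrite ax (le_trans xc).
by rewrite gac ?ax// xP addrC subrK.
Qed.

(** The subdivision of [A, B] is pulled back along f: a breaking point C comes from $a + 2^{-k}(C -
    A)$, again dyadic, and the slopes multiply. *)
Lemma pl_comp_affine g A B : pl g A B -> forall f a b (k : int),
  dyadic a -> a <= b -> f a = A -> f b = B ->
  (forall x, a <= x <= b -> f x = f a + 2 ^ k * (x - a)) -> pl (g \o f) a b.
Proof.
elim=> [{}A dA|{}A C {}B l dA AC gAC CB IH] f a b k da ab fa fb fk.
  have : 2 ^ k * (b - a) = 0.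
    by have := fk b; rewrite ab lexx fa fb => /(_ isT); lra.
  move/eqP; rewrite mulf_eq0 gt_eqF ?exp2_gt0//= subr_eq0 => /eqP ->.
  exact: pl_nil.
have P := exp2_gt0 k; have dC : dyadic C by have [] := pl_dyadic CB.
have CB' := pl_le CB.
pose c := a + 2 ^ (- k) * (C - A).
have kc : 2 ^ k * (c - a) = C - A.
  by rewrite /c addrAC subrr add0r mulrA -expfzDr ?subrr ?mul1r.
have dc : dyadic c by apply/dyadicD/dyadicZ/dyadicD/dyadicN.
have ac : a < c by rewrite ltrDl mulr_gt0 ?exp2_gt0// subr_gt0.
have cb : c <= b.
  rewrite -(lerD2r (- a)) -(ler_pM2l P) kc.
  by have := fk b; rewrite ab lexx fa fb => /(_ isT); lra.
have fc : f c = C by rewrite fk ?(ltW ac) ?cb// fa kc; ring.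
have fac x : a <= x <= c -> A <= f x <= C.
  move=> /andP[ax xc]; rewrite fk ?ax ?(le_trans xc)// fa.
  have : 0 <= 2 ^ k * (x - a) by rewrite mulr_ge0 ?subr_ge0// ltW.
  have : 2 ^ k * (x - a) <= C - A by rewrite -kc ler_pM2l// lerD2r.
  lra.
apply: (pl_cons (k := l + k) da ac).
  move=> x axc /=; rewrite [g (f x)]gAC ?fac// fa [f x]fk ?fa.
    by rewrite expfzDr ?pnatr_eq0//; ring.
  by case/andP: axc => -> /le_trans ->.
apply: (IH f c b k) => // x /andP[cx xb].
by rewrite fc fk ?xb ?(le_trans (ltW ac))// fa -[C](subrK A) -kc; ring.
Qed.

(** For each affine piece [a, c] of f, the subdivision of g is cut at the dyadic point [f c] and
    [pl_comp_affine] applies. *)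
Lemma pl_comp f g a b : pl f a b -> pl g (f a) (f b) -> pl (g \o f) a b.
Proof.
elim=> [c dc _|{}a c {}b k da ac fac cb IH gab]; first exact: pl_nil.
have df : dyadic (f c).
  have [dfa _] := pl_dyadic gab; have [dc _] := pl_dyadic cb.
  rewrite fac ?lexx ?(ltW ac)//; apply: dyadicD => //.
  by apply/dyadicZ/dyadicD/dyadicN.
have acb := pl_cons da ac fac cb; have cb' := pl_le cb.
have [|g1 g2] := pl_split df _ gab.
  have L := pl_lt acb; apply/andP; split; first by rewrite ltW// L.
  move: cb'; rewrite le_eqVlt => /predU1P[->//|cb'].
  by rewrite ltW// L// ltW.
apply: pl_cat (IH g2).
exact: pl_comp_affine g1 _ _ _ k da (ltW ac) erefl erefl fac.
Qed.

Lemma pl_inc g a b : pl g a b -> {in `[a, b] &, {mono g : x y / x <= y}}.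
Proof.
move=> h; apply: le_mono_in => x y; rewrite !in_itv /= => /andP[ax _] /andP[_ yb] xy.
exact: pl_lt h _ _ ax xy yb.
Qed.

Lemma pl_dyadic_piecewise_linear g : pl g 0 1 -> dyadic_piecewise_linear g.
Proof.
suff H a b : pl g a b -> exists s : seq R,
    [/\ {in s, forall t, dyadic t}, path <%R a s, last a s = b
      & forall i, (i < size s)%N -> exists (k : int) (c : R),
          forall x, x \in `[nth 0 (a :: s) i, nth 0 (a :: s) i.+1] ->
            g x = 2 ^ k * x + c] by exact: H.
elim=> [c dc|{}a c {}b k da ac gac cb [s [ds ps ls hs]]]; first by exists [::].
exists (c :: s); split => //.
- by have [dc _] := pl_dyadic cb; move=> t; rewrite inE => /predU1P[->//|/ds].
- by rewrite /= ac.
- case=> [_|i]; last by move=> /hs.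
  exists k, (g a - 2 ^ k * a) => x; rewrite in_itv => /gac ->; ring.
Qed.

(** An increasing surjection between segments is continuous; this applies to g and to its
    inverse. *)
Lemma pl_thompson n g : (forall x, x \notin `[0, 1] -> g x = 0) ->
  pl g 0 1 -> g 0 = 0 -> g 1 = n%:R -> thompson n g.
Proof.
move=> g_out h g0 g1; have inc := pl_inc h.
have i0 : (0 : R) \in `[0, 1] by rewrite in_itv /= lexx ler01.
have i1 : (1 : R) \in `[0, 1] by rewrite in_itv /= lexx ler01.
split => //; last exact: pl_dyadic_piecewise_linear.
have surj y : exists x, y \in `[0, n%:R] -> x \in `[0, 1] /\ g x = y.
  have [yn|] := boolP (y \in `[0, n%:R]); last by exists 0.
  by have [|x x01 <-] := pl_surj h (y := y); [rewrite g0 g1|exists x].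
have [hi hiP] := choice surj.
have gK : {in `[0, 1], cancel g hi}.
  move=> x x01; have : g x \in `[0, n%:R].
    by rewrite in_itv /= -g0 -g1 !inc//.
  move=> /hiP[h01 e]; apply: le_anti.
  by rewrite -(inc _ _ h01 x01) -(inc _ _ x01 h01) e lexx.
have hom : {homo g : x / x \in `[0, 1] >-> x \in `[0, n%:R]}.
  by move=> x x01; rewrite in_itv /= -g0 -g1 !inc//.
exists hi; split.
- by move=> x; rewrite /= => /hom.
- by move=> y; rewrite /= => /hiP[].
- by move=> x; rewrite inE => /gK.
- by move=> y; rewrite inE => /hiP[].
have n0 : hi 0 = 0 by rewrite -g0 gK.
have n1 : hi n%:R = 1 by rewrite -g1 gK.
split.
  apply: segment_inc_surj_continuous => //.
  by rewrite g0 g1 => y /hiP[? <-]; exists (hi y).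
apply: segment_inc_surj_continuous => //.
  by move=> x y /hiP[hx ex] /hiP[hy ey]; rewrite -[in RHS]ex -[in RHS]ey inc.
by rewrite n0 n1 => x /= x01; exists (g x); [exact: hom|exact: gK].
Qed.

Lemma pl_rho_pow (k : int) : pl (@rho_pow R k) 0 1.
Proof.
have d0 : dyadic (0 : R) := dyadic_int 0.
have d1 : dyadic (1 : R) := dyadic_int 1.
have D (p q : nat) (x : R) : x = p%:R / 2 ^+ q -> dyadic x.
  by move=> ->; exists p%:Z, q.
have d2 : dyadic (2^-1 : R) by apply: (D 1 1)%N; rewrite expr1 mul1r.
have d4 : dyadic (4^-1 : R) by apply: (D 1 2)%N; rewrite -natrX mul1r.
have d34 : dyadic (3 / 4 : R) by apply: (D 3 2)%N; rewrite -natrX.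
have hrho : pl (@rho R) 0 1.
  apply: (pl_cons (b := 4^-1) (k := 1)) => //; try lra.
    by move=> x hx; rewrite expr1z; do 2![case: rhoP => ?]; lra.
  apply: (pl_cons (b := 2^-1) (k := 0)) => //; try lra.
    by move=> x hx; rewrite expr0z; do 2![case: rhoP => ?]; lra.
  apply: (pl_affine (k := -1)) => //; try lra.
  by move=> x hx; rewrite exprN1; do 2![case: rhoP => ?]; lra.
have hinv : pl (@rho_inv R) 0 1.
  apply: (pl_cons (b := 2^-1) (k := -1)) => //; try lra.
    by move=> x hx; rewrite exprN1; do 2![case: rho_invP => ?]; lra.
  apply: (pl_cons (b := 3 / 4) (k := 0)) => //; try lra.
    by move=> x hx; rewrite expr0z; do 2![case: rho_invP => ?]; lra.
  apply: (pl_affine (k := 1)) => //; try lra.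
  by move=> x hx; rewrite expr1z; do 2![case: rho_invP => ?]; lra.
elim: k => [|d IH|d IH].
- by apply: (pl_affine (k := 0)) => // x _; rewrite expr0z mul1r subr0 add0r.
- apply: (eq_pl (f := @rho R \o rho_pow d)) => [x _|].
    by rewrite -addn1 PoszD rho_powS.
  by apply: pl_comp IH _; rewrite rho_pow0 rho_pow1.
- apply: (eq_pl (f := @rho_inv R \o rho_pow (- d%:Z))) => [x _|].
    by rewrite -addn1 PoszD opprD rho_powB1.
  by apply: pl_comp IH _; rewrite rho_pow0 rho_pow1.
Qed.

End PL.

(** * Vertices of the flat *)

Section Pairs.
Variable N : nat.

Lemma pair_ord_subproof (i : 'I_N) (b : bool) : (i.*2 + b < N.*2)%N.
Proof. by have := ltn_ord i; case: b; lia. Qed.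

(** The indices of the unit intervals [2i, 2i + 1] and [2i + 1, 2i + 2] that form the image of block
    i. *)
Definition pair_ord i b : 'I_(N.*2) := Ordinal (pair_ord_subproof i b).

Lemma pair_ord_inj i i' b b' : pair_ord i b = pair_ord i' b' -> i = i' /\ b = b'.
Proof.
move=> /(congr1 val) /= e; have bb : b = b'.
  by move: (congr1 odd e); rewrite !oddD !odd_double !oddb.
by split=> //; apply: val_inj; move: e; rewrite bb => /addIn /double_inj.
Qed.

Lemma pair_ordP (j : 'I_(N.*2)) : exists i b, j = pair_ord i b.
Proof.
have jN : (j./2 < N)%N by have := ltn_ord j; lia.
by exists (Ordinal jN), (odd j); apply: val_inj; rewrite /= addnC odd_double_half.
Qed.

Lemma sum_pair_ord (V : zmodType) (F : 'I_(N.*2) -> V) :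
  \sum_j F j = \sum_i (F (pair_ord i false) + F (pair_ord i true)).
Proof.
rewrite [RHS](eq_bigr (fun i => \sum_(b : bool) F (pair_ord i b))); last first.
  by move=> i _; rewrite big_bool addrC.
rewrite pair_big /= (reindex (fun p => pair_ord p.1 p.2))//=.
apply/onW_bij/inj_card_bij => [[i b] [i' b']/= /pair_ord_inj[-> ->]//|].
by rewrite card_prod card_bool !card_ord muln2.
Qed.

End Pairs.

(** * Block functions and the vertex labels built from them *)

Section Blocks.
Variable R : realType.
Implicit Types (x y t : R).

Definition clamp y : R := Num.min 1 (Num.max 0 y).

Variant clamp_spec y : R -> Type :=
| ClampLow of y <= 0 : clamp_spec y 0
| ClampMid of 0 <= y <= 1 : clamp_spec y y
| ClampHigh of 1 <= y : clamp_spec y 1.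

Lemma clampP y : clamp_spec y (clamp y).
Proof.
rewrite /clamp; case: (leP y 0) => h0; first by rewrite min_r//; exact: ClampLow.
case: (leP y 1) => h1; last exact: ClampHigh (ltW h1).
by apply: ClampMid; rewrite ltW.
Qed.

Lemma sum_ltn (n i : nat) : (i <= n)%N ->
  \sum_(j < n) ((j < i)%N%:R : R) = i%:R.
Proof.
move=> le_in; rewrite -natr_sum; congr (_%:R).
rewrite -(big_mkord xpredT (fun j => (j < i)%N : nat)) (big_cat_nat _ le_in)//=.
rewrite big_nat (eq_bigr (fun=> 1%N)) => [|j /andP[_ ->]//].
rewrite -big_nat sum_nat_const_nat subn0 muln1 big_nat big1 ?addn0// => j.
by rewrite leqNgt => /andP[/negbTE ->].
Qed.

(** Evaluates a sum of translated blocks at a point of block i: earlier blocks are saturated at 2,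
    later ones vanish. *)
Lemma sum_step (n : nat) (F : 'I_n -> R) (i : 'I_n) :
  (forall j : 'I_n, (j < i)%N -> F j = 2) ->
  (forall j : 'I_n, (i < j)%N -> F j = 0) ->
  \sum_j F j = i.*2%:R + F i.
Proof.
move=> F2 F0.
rewrite (eq_bigr (fun j : 'I_n => 2 * (j < i)%N%:R + (if j == i then F i else 0))).
  rewrite big_split /= -mulr_sumr sum_ltn ?(ltnW (ltn_ord i))//.
  by rewrite -big_mkcond big_pred1_eq -natrM mul2n.
move=> j _; case: (ltngtP j i) => [ji|ij|/val_inj ->].
- by rewrite F2// -val_eqE /= ltn_eqF// mulr1 addr0.
- by rewrite F0// -val_eqE /= gtn_eqF// mulr0 addr0.
- by rewrite eqxx mulr0 add0r.
Qed.

(** The vertex $v_k = 2\rho^{-k}$, continued by constants so that translated blocks can be added. *)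
Definition block (k : int) y : R := 2 * rho_pow (- k) (clamp y).

Lemma block_low (k : int) y : y <= 0 -> block k y = 0.
Proof.
by rewrite /block => y0; case: clampP => [|/andP[? _]|?]; rewrite ?rho_pow0 ?mulr0//;
  [have -> : y = 0 by lra|exfalso; lra]; rewrite rho_pow0 mulr0.
Qed.

Lemma block_high (k : int) y : 1 <= y -> block k y = 2.
Proof.
by rewrite /block => y0; case: clampP => [?|/andP[_ ?]|];
  rewrite ?rho_pow1 ?mulr1//; [exfalso; lra|have -> : y = 1 by lra];
  rewrite rho_pow1 mulr1.
Qed.

Lemma clamp01 y : 0 <= clamp y <= 1.
Proof. by case: clampP => // _; rewrite lexx ler01. Qed.

Lemma clamp_id y : 0 <= y <= 1 -> clamp y = y.
Proof. by move=> ?; case: clampP; lra. Qed.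

Lemma block_itv (k : int) y : 0 <= block k y <= 2.
Proof. by have := rho_pow01 (- k) (clamp01 y); rewrite /block; lra. Qed.

(* The pointwise form of v_k[{2}] = v_{k+1}[{1}]. *)
Lemma block_glue (k : int) y :
  block k y + clamp (block k y - 1) = block (k + 1) y + clamp (block (k + 1) y).
Proof.
rewrite /block opprD rho_powB1; have := rho_pow01 (- k) (clamp01 y).
set w := rho_pow _ _ => w01.
by case: rho_invP => ?; do 2![case: clampP => ?]; lra.
Qed.

Variable r : nat.
Let N := (2 ^ r)%N.

Definition flat_fun (k : 'I_N -> int) y : R := \sum_(i < N) block (k i) (y - i%:R).

Lemma flat_fun_itv k (i : 'I_N) y : i%:R <= y <= i.+1%:R ->
  flat_fun k y = i.*2%:R + block (k i) (y - i%:R).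
Proof.
move=> /andP[iy yi]; apply: sum_step => j ij.
  rewrite block_high// lerBrDr; apply: le_trans iy.
  by rewrite nat1r ler_nat.
by rewrite block_low// subr_le0 (le_trans yi)// ler_nat.
Qed.

Lemma flat_fun0 k : flat_fun k 0 = 0.
Proof. by apply: big1 => i _; rewrite block_low// sub0r oppr_le0. Qed.

Lemma flat_fun1 k : flat_fun k N%:R = N.*2%:R.
Proof.
rewrite /flat_fun (eq_bigr (fun=> 2)).
  by rewrite sumr_const card_ord -mulrnA mul2n.
move=> i _; apply: block_high; rewrite lerBrDr nat1r ler_nat //.
Qed.

(** This is $V_k$; the value 0 outside [0, 1] is the convention of [thompson]. *)
Definition flat_label (k : 'I_N -> int) x : R :=
  if x \in `[0, 1] then flat_fun k (N%:R * x) else 0.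

Lemma N_gt0 : (0 : R) < N%:R.
Proof. by rewrite ltr0n expn_gt0. Qed.

Lemma dyadicN_div (i : nat) : dyadic (i%:R / N%:R : R).
Proof. by exists i%:Z, r; rewrite natrX. Qed.

(** On block i the label is the composite of $x \mapsto Nx - i$, [rho_pow (- k i)] and $z \mapsto 2i
    + 2z$; the first has slope $N = 2^r$, a power of 2. *)
Lemma pl_flat_label_block k (i : 'I_N) :
  pl (flat_label k) (i%:R / N%:R) (i.+1%:R / N%:R).
Proof.
have d0 : dyadic (0 : R) := dyadic_int R 0.
have d1 : dyadic (1 : R) := dyadic_int R 1.
have N0 := N_gt0; have N1 : (N%:R : R) != 0 by rewrite gt_eqF.
have h01 : i%:R / N%:R <= i.+1%:R / N%:R :> R.
  by rewrite ler_pM2r ?invr_gt0// ler_nat.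
have outer : pl (fun z : R => i.*2%:R + 2 * z) 0 1.
  apply: (pl_affine (k := 1)) => // x _; rewrite expr1z; ring.
have h : pl ((fun z : R => i.*2%:R + 2 * z) \o rho_pow (- k i)) 0 1.
  by apply: pl_comp (pl_rho_pow _ _) _; rewrite rho_pow0 rho_pow1.
have := @pl_comp_affine _ _ _ _ h (fun x => N%:R * x - i%:R)
  (i%:R / N%:R) (i.+1%:R / N%:R) r (dyadicN_div i) h01.
move=> /(_ _ _ _)/eq_pl; apply.
- move=> x /andP[ix xi].
  have b1 : i%:R <= N%:R * x by rewrite mulrC -ler_pdivrMr.
  have b2 : N%:R * x <= i.+1%:R by rewrite mulrC -ler_pdivlMr.
  have xin : x \in `[0, 1].
    rewrite in_itv /=; apply/andP; split.
      by apply: le_trans ix; rewrite divr_ge0.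
    by apply: le_trans xi _; rewrite ler_pdivrMr// mul1r ler_nat.
  rewrite /flat_label xin (@flat_fun_itv _ i) ?b1//= /block clamp_id//.
  by rewrite subr_ge0 b1 lerBlDr nat1r.
- by rewrite mulrC divfK// subrr.
- by rewrite mulrC divfK// -natr1; ring.
- by move=> x _; rewrite -exprnP -natrX -/N; ring.
Qed.

Lemma flat_label_thompson k : thompson N.*2 (flat_label k).
Proof.
have i0 : (0 : R) \in `[0, 1] by rewrite in_itv /= lexx ler01.
have i1 : (1 : R) \in `[0, 1] by rewrite in_itv /= lexx ler01.
apply: pl_thompson => [x /negbTE xout|||].
- by rewrite /flat_label xout.
- suff H n : (n <= N)%N -> pl (flat_label k) 0 (n%:R / N%:R).
    by have := H N (leqnn N); rewrite divff// gt_eqF// N_gt0.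
  elim: n => [_|n IH nN]; first by rewrite mul0r; exact/pl_nil/(dyadic_int R 0).
  apply: pl_cat (IH (ltnW nN)) (pl_flat_label_block k (Ordinal nN)).
- by rewrite /flat_label i0 mulr0 flat_fun0.
- by rewrite /flat_label i1 mulr1 flat_fun1.
Qed.

(** Before block i the function is at most 2i and after it at least 2i + 2, where both clamps are
    saturated. So splitting a piece of block i affects this block only. *)
Lemma clamp_flat_fun k y (i : 'I_N) (b : bool) :
  clamp (flat_fun k y - (pair_ord i b)%:R) = clamp (block (k i) (y - i%:R) - b%:R).
Proof.
have [yi|iy] := leP y i%:R.
  have -> : block (k i) (y - i%:R) = 0 by rewrite block_low// subr_le0.
  have : flat_fun k y <= i.*2%:R.
    rewrite -muln2 natrM -(sum_ltn (ltnW (ltn_ord i))) mulr_suml.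
    apply: ler_sum => j _; case: ltnP => ij; rewrite ?mul1r ?mul0r.
      by have /andP[] := block_itv (k j) (y - j%:R).
    by rewrite block_low// subr_le0 (le_trans yi)// ler_nat.
  rewrite /= natrD; move: (flat_fun _ _) => f.
  by have : (0 : R) <= b%:R by []; do 2![case: clampP => ?]; lra.
have [iy'|yi] := leP i.+1%:R y.
  have -> : block (k i) (y - i%:R) = 2 by rewrite block_high// lerBrDr nat1r.
  have : i.*2%:R + 2 <= flat_fun k y.
    rewrite -muln2 natrM -[X in _ + X <= _]mul1r -mulrDl natr1.
    rewrite -(sum_ltn (ltn_ord i)) mulr_suml.
    apply: ler_sum => j _; case: ltnP => ij; rewrite ?mul1r ?mul0r.
      by rewrite block_high// lerBrDr (le_trans _ iy')// nat1r ler_nat.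
    by have /andP[] := block_itv (k j) (y - j%:R).
  rewrite /= natrD; move: (flat_fun _ _) => f.
  have : (b%:R : R) <= 1 by case: b.
  by do 2![case: clampP => ?]; lra.
rewrite (@flat_fun_itv _ i) ?ltW//= natrD; congr clamp; ring.
Qed.

Lemma split_flat_label k (J : {set 'I_N.*2}) x : x \in `[0, 1] ->
  split_label (flat_label k) J x = \sum_i (block (k i) (N%:R * x - i%:R)
    + ((if pair_ord i false \in J then clamp (block (k i) (N%:R * x - i%:R)) else 0)
    + (if pair_ord i true \in J then clamp (block (k i) (N%:R * x - i%:R) - 1) else 0))).
Proof.
move=> x01; rewrite /split_label /split_map /= {1}/flat_label x01 big_split/=.
congr (_ + _); rewrite big_mkcond sum_pair_ord; apply: eq_bigr => i _.
have := @clamp_flat_fun k (N%:R * x) i; rewrite /flat_label x01 /clamp => H.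
by rewrite !H subr0.
Qed.

(** By [split_flat_label] the comparison is made block by block: block i0 is [block_glue], the
    others agree. Neighbouring cells of the flat are glued along this equality. *)
Lemma split_flat_label_glue k k' (i0 : 'I_N) (J J' : {set 'I_N.*2}) :
  k' i0 = k i0 + 1 -> (forall i, i != i0 -> k' i = k i) ->
  pair_ord i0 true \in J -> pair_ord i0 false \notin J ->
  pair_ord i0 false \in J' -> pair_ord i0 true \notin J' ->
  (forall i b, i != i0 -> (pair_ord i b \in J) = (pair_ord i b \in J')) ->
  split_label (flat_label k) J = split_label (flat_label k') J'.
Proof.
move=> k1 kk tJ fJ fJ' tJ' JJ; apply/funext => x.
have [x01|x01] := boolP (x \in `[0, 1]); last first.
  rewrite /split_label /= /flat_label (negbTE x01) /split_map.
  by rewrite !big1// => j _; rewrite max_l ?min_r// sub0r oppr_le0.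
rewrite !split_flat_label//; apply: eq_bigr => i _.
have [->|ii0] := eqVneq i i0; last by rewrite !JJ// kk.
rewrite tJ fJ' (negbTE fJ) (negbTE tJ') k1 add0r addr0; exact: block_glue.
Qed.

End Blocks.

(** * The flat and the upper bound *)

Section Strings.
Variable R : realType.
Implicit Types P Q S : X R.

Definition stringed P Q (L : R) : Prop :=
  exists (k : nat) (z : nat -> X R) (l : nat -> R),
    [/\ z 0%N = P, z k = Q,
        forall i, (i < k)%N -> cube_dist (z i) (z i.+1) (l i)
      & L = \sum_(i < k) l i].

Lemma stringed1 P Q l : cube_dist P Q l -> stringed P Q l.
Proof.
move=> h; exists 1%N, (fun i => if i is 0%N then P else Q), (fun=> l).
by split=> // [[]//|]; rewrite big_ord1.
Qed.

Lemma stringed_cons P Q S l L :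
  cube_dist P Q l -> stringed Q S L -> stringed P S (l + L).
Proof.
move=> h [k [z [d [z0 zk zd ->]]]].
exists k.+1, (fun i => if i is j.+1 then z j else P), (fun i => if i is j.+1 then d j else l).
split=> // [[_|i /zd//]|]; first by rewrite z0.
by rewrite big_ord_recl.
Qed.

Lemma dX_le P Q L : stringed P Q L -> (dX P Q <= L%:E)%E.
Proof.
move=> [k [z [l [z0 zk zl ->]]]]; apply: ereal_inf_lbound.
by exists k, z, l.
Qed.

Lemma le_dX P Q (d : R) : (forall L, stringed P Q L -> d <= L) -> (d%:E <= dX P Q)%E.
Proof.
move=> h; apply: le_ereal_inf_tmp => _ [k [z [l [z0 zk zl ->]]]].
by rewrite lee_fin; apply: h; exists k, z, l.
Qed.

End Strings.

(** * Cells of the flat and chains along its segments *)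

Section Flat.
Variables (R : realType) (r : nat).
Let N := (2 ^ r)%N.
Implicit Types (k l : 'I_N -> int) (c : 'I_N -> R).

Definition incell k c : Prop := forall i, (k i)%:~R <= c i <= (k i)%:~R + 1.

Lemma half_ord_subproof (j : 'I_N.*2) : (j./2 < N)%N.
Proof. by rewrite ltn_half_double. Qed.

Definition half_ord (j : 'I_N.*2) : 'I_N := Ordinal (half_ord_subproof j).

Lemma half_pair_ord i b : half_ord (pair_ord i b) = i.
Proof. by apply: val_inj; rewrite /= addnC half_bit_double. Qed.

Lemma odd_pair_ord (i : 'I_N) b : odd (pair_ord i b) = b.
Proof. by rewrite /= oddD odd_double oddb. Qed.

(** As [c i] runs from [k i] to [k i + 1], the coordinates of block i run from (1, 0), where the
    first piece is split, to (0, 1), where the second one is. *)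
Definition flat_pos k c : 'rV[R]_N.*2 := \row_j
  (let x := c (half_ord j) - (k (half_ord j))%:~R in if odd j then x else 1 - x).

Lemma flat_posE k c i b : flat_pos k c 0 (pair_ord i b) =
  if b then c i - (k i)%:~R else 1 - (c i - (k i)%:~R).
Proof. by rewrite mxE odd_pair_ord half_pair_ord. Qed.

Lemma flat_pos01 k c : incell k c -> forall j, 0 <= flat_pos k c 0 j <= 1.
Proof.
move=> kc j; have [i [b ->]] := pair_ordP j.
by rewrite flat_posE; have := kc i; case: b; lra.
Qed.

Lemma flat_dim_gt0 : (0 < N.*2)%N.
Proof. by rewrite double_gt0 expn_gt0. Qed.

Definition flat_cube_point k c (kc : incell k c) : cube_point R :=
  CubePoint flat_dim_gt0 (flat_label_thompson R k) (flat_pos01 kc).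

Definition flat_point k c (kc : incell k c) : X R := to_X (flat_cube_point kc).

(** The factor 2 appears because [c i] moves two coordinates of the cube at equal speed. *)
Definition flat_dist c c' : R := Num.sqrt (\sum_i 2 * (c i - c' i) ^+ 2).

Lemma enorm_flat_pos k c c' : enorm (flat_pos k c - flat_pos k c') = flat_dist c c'.
Proof.
have E i b : (flat_pos k c - flat_pos k c') 0 (pair_ord i b) =
    if b then c i - c' i else c' i - c i.
  by rewrite mxE [X in _ + X]mxE !flat_posE; case: b; ring.
by congr Num.sqrt; rewrite sum_pair_ord; apply: eq_bigr => i _; rewrite !E; ring.
Qed.

Lemma cube_dist_flat k c c' (kc : incell k c) (kc' : incell k c') :
  cube_dist (flat_point kc) (flat_point kc') (flat_dist c c').
Proof.
exists N.*2, (flat_label k), flat_dim_gt0, (flat_label_thompson R k).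
exists (flat_pos k c), (flat_pos k c'), (flat_pos01 kc), (flat_pos01 kc').
by split=> //; rewrite enorm_flat_pos.
Qed.

(** On the common wall [c i0 = k i0 + 1] the point has coordinates (0, 1) in block i0 of the first
    cube and (1, 0) in the second. The transposition of these two coordinates identifies the faces,
    with labels matched by [split_flat_label_glue]. *)
Lemma flat_point_glue k k' (i0 : 'I_N) c (kc : incell k c) (kc' : incell k' c) :
  k' i0 = k i0 + 1 -> (forall i, i != i0 -> k' i = k i) ->
  flat_point kc = flat_point kc'.
Proof.
move=> k1 kk; apply/eqmodP/asboolP/rst_step.
pose a := pair_ord i0 false; pose b := pair_ord i0 true.
have ab : a != b by apply/eqP => /pair_ord_inj[].
have ci0 : c i0 = (k i0)%:~R + 1.
  have := kc i0; have := kc' i0; rewrite k1 intrD; lra.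
pose sw (J : {set 'I_N.*2}) := tperm a b @^-1: J.
have swK J : sw (sw J) = J by apply/setP => j; rewrite !inE tpermK.
have chi_sw J : chi R J *m tperm_mx a b + 0 = chi R (sw J).
  by rewrite addr0 -xcolE; apply/rowP => j; rewrite !mxE inE.
have other i b' : i != i0 -> tperm a b (pair_ord i b') = pair_ord i b'.
  by move=> ii0; rewrite tpermD//; apply/eqP => /pair_ord_inj[/esym/eqP]; rewrite (negbTE ii0).
have label (J : {set 'I_N.*2}) : b \in J -> a \notin J ->
    split_label (flat_label k : R -> R) J = split_label (flat_label k') (sw J).
  move=> bJ aJ; apply: (@split_flat_label_glue R r k k' i0) => //;
    try by rewrite inE ?tpermL ?tpermR.
  by move=> i b' ii0; rewrite inE other.
exists [set b], (~: [set a]), [set a], (~: [set b]), (tperm_mx a b), 0; split.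
- by rewrite !finset.sub1set !inE eq_sym ab.
- move=> J [bJ Ja]; exists (sw J); split=> //.
    rewrite finset.sub1set in bJ; rewrite finset.subsetC finset.sub1set inE in Ja.
    by rewrite finset.sub1set finset.subsetC finset.sub1set !inE tpermL tpermR bJ.
  by apply: label; [rewrite finset.sub1set in bJ|rewrite finset.subsetC finset.sub1set inE in Ja].
- move=> J [aJ Jb]; exists (sw J); rewrite chi_sw swK.
  rewrite finset.sub1set in aJ; rewrite finset.subsetC finset.sub1set inE in Jb.
  have bs : b \in sw J by rewrite inE tpermR.
  have as' : a \notin sw J by rewrite inE tpermL.
  split=> //; first by rewrite finset.sub1set bs finset.subsetC finset.sub1set inE as'.
  by rewrite label// swK.
- move=> j; split; first exact: (flat_pos01 kc).
    by rewrite inE => /eqP ->; rewrite /= flat_posE ci0; ring.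
  by rewrite !inE negbK => /eqP ->; rewrite /= flat_posE ci0; ring.
- rewrite addr0 -xcolE; apply/rowP => j; rewrite [RHS]mxE /=.
  have [i [b' ->]] := pair_ordP j.
  have [->|ii0] := eqVneq i i0; last by rewrite other// !flat_posE kk.
  by case: b'; rewrite ?tpermL ?tpermR !flat_posE k1 ci0 intrD; ring.
Qed.

Definition seg c c' (t : R) (i : 'I_N) : R := c i + t * (c' i - c i).

Lemma flat_dist_segl c c' t : 0 <= t -> flat_dist c (seg c c' t) = t * flat_dist c c'.
Proof.
move=> t0; rewrite /flat_dist -[in RHS](ger0_norm t0) -sqrtr_sqr -sqrtrM ?sqr_ge0//.
by congr Num.sqrt; rewrite mulr_sumr; apply: eq_bigr => i _; rewrite /seg; ring.
Qed.

Lemma flat_dist_segr c c' t : t <= 1 ->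
  flat_dist (seg c c' t) c' = (1 - t) * flat_dist c c'.
Proof.
rewrite -subr_ge0 => t0.
rewrite /flat_dist -[in RHS](ger0_norm t0) -sqrtr_sqr -sqrtrM ?sqr_ge0//.
by congr Num.sqrt; rewrite mulr_sumr; apply: eq_bigr => i _; rewrite /seg; ring.
Qed.

(** For [k i != l i], [t i] is the time at which the segment meets the wall of cell k facing l. The
    least of these times is taken, and [k'] is the cell behind that wall. *)
Lemma first_wall k l c c' : incell k c -> incell l c' -> k <> l ->
  exists (t : R) (k' : 'I_N -> int) (i0 : 'I_N), [/\ 0 <= t <= 1,
    incell k (seg c c' t) /\ incell k' (seg c c' t),
    (k' i0 = k i0 + 1 /\ k i0 < l i0) \/ (k' i0 = k i0 - 1 /\ l i0 < k i0)
    & forall i, i != i0 -> k' i = k i].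
Proof.
move=> kc lc kl.
have [i1 i1P] : exists i, k i != l i.
  apply: contrapT => H; apply: kl; apply/funext => i; apply/eqP.
  by apply/negPn/negP => kli; apply: H; exists i.
pose wall i : R := if k i < l i then (k i)%:~R + 1 else (k i)%:~R.
pose t i := (wall i - c i) / (c' i - c i).
have intle (m n : int) : m < n -> m%:~R + 1 <= n%:~R :> R.
  by move=> mn; rewrite -(intrD _ m 1) ler_int; lia.
have wallP i : k i != l i -> 0 <= t i <= 1 /\ seg c c' (t i) i = wall i.
  (* If [c' i = c i], the point is on the wall all along, and division by zero gives the correct
     time 0. *)
  move=> kli; rewrite /seg /t; have [cc|cc] := eqVneq (c' i - c i) 0.
    rewrite cc invr0 !mulr0 lexx ler01; split=> //; rewrite addr0 /wall.
    have := kc i; have := lc i; case: (ltgtP (k i) (l i)) kli => // /intle; lra.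
  rewrite divfK//; split; last by ring.
  have := kc i; have := lc i; rewrite /wall; case: (ltgtP (k i) (l i)) kli => // /intle H _ h1 h2.
    have c0 : 0 < c' i - c i by rewrite lt_def cc; lra.
    by rewrite divr_ge0 ?ler_pdivrMr//; lra.
  have c0 : 0 < c i - c' i by rewrite lt_def -opprB oppr_eq0 cc; lra.
  rewrite -[c' i - c i]opprB invrN mulrN -mulNr.
  by rewrite divr_ge0 ?ler_pdivrMr//; lra.
have [i0 i0P i0min] := @arg_minP _ _ _ i1 (fun i => k i != l i) t i1P.
have [t01 ti0] := wallP _ i0P.
(* Coordinates with [k i = l i] stay in the cell by convexity; the others have not passed their
   wall, as [t i0 <= t i]. *)
have inseg : incell k (seg c c' (t i0)).
  move=> i; have := kc i; have := lc i; have [kli|kli] := eqVneq (k i) (l i).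
    rewrite kli /seg; nra.
  have [ti e] := wallP _ kli; have := i0min i kli.
  move: e; rewrite /seg /wall; case: (ltgtP (k i) (l i)) kli => // /intle H _; nra.
exists (t i0), (fun i => if i == i0 then (if k i0 < l i0 then k i0 + 1 else k i0 - 1) else k i), i0.
split=> //; last by move=> i /negbTE ->.
- split=> // i; case: eqVneq => [->|_]; last exact: inseg.
  rewrite ti0 /wall; case: ifP => _; rewrite ?intrD ?intrB; lra.
- by rewrite eqxx; case: (ltgtP (k i0) (l i0)) i0P => // h _; [left|right].
Qed.

(** Induction on $\sum_i |k_i - l_i|$: going to the first wall and renaming the point in the cell
    behind it lowers this sum, and lengths add up along the segment. *)
Lemma stringed_flat k l c c' (kc : incell k c) (lc : incell l c') :
  stringed (flat_point kc) (flat_point lc) (flat_dist c c').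
Proof.
have [n] := ubnP (\sum_i `|(k i - l i)%R|)%N.
elim: n => // n IH in k c kc *; rewrite ltnS => nle.
have [kl|/eqP kl] := eqVneq k l.
  subst l; apply: stringed1; exact: cube_dist_flat.
have [t [k' [i0 [/andP[t0 t1] [wc wc'] step kk]]]] := first_wall kc lc kl.
have glue : flat_point wc = flat_point wc'.
  case: step => [[k1 _]|[k1 _]]; first exact: flat_point_glue k1 kk.
  apply/esym/(@flat_point_glue _ _ i0) => [|i /kk//].
  by rewrite k1 subrK.
rewrite (_ : flat_dist c c' = flat_dist c (seg c c' t) + flat_dist (seg c c' t) c'); last first.
  by rewrite flat_dist_segl// flat_dist_segr//; ring.
apply: stringed_cons (cube_dist_flat kc wc) _; rewrite glue; apply: IH.
apply: leq_trans nle; rewrite (bigD1 i0)//= [ltnRHS](bigD1 i0)//=.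
rewrite -addSn; apply: leq_add; first by case: step => [[-> ?]|[-> ?]]; lia.
by apply: leq_sum => i /kk ->.
Qed.

End Flat.

(** * Hyperplanes *)

Section Hyperplanes.
Variable R : realType.
Implicit Types (g psi gam : R -> R) (n : nat).

(* For gam = g \o psi, where psi : [0, 1] -> [0, 1] stands for a hyperplane,
   piece gam j says that psi is the inverse of the j-th piece of g, and below gam
   that some iterated splitting of g has such a piece, that is, that g lies on
   the side of the hyperplane where psi has not been split yet. *)
Definition piece gam (j : nat) : Prop := forall t, 0 <= t <= 1 -> gam t = j%:R + t.

Definition below gam : Prop := exists c e : nat,
  forall t, 0 <= t <= 1 -> gam t = (c%:R + t) / 2 ^+ e.

Lemma piece_below gam j : piece gam j -> below gam.
Proof. by move=> h; exists j, 0%N => t /h ->; rewrite expr0 divr1. Qed.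

Lemma split_map_lt n (J : {set 'I_n}) (x y : R) : x < y -> split_map J x < split_map J y.
Proof.
move=> xy; rewrite /split_map ltr_leD// ler_sum// => j _.
by rewrite -!/(clamp _); do 2![case: clampP => ?]; lra.
Qed.

Lemma split_map_mono n (J : {set 'I_n}) : {mono (split_map J : R -> R) : x y / x <= y}.
Proof. by apply: le_mono => x y; exact: split_map_lt. Qed.

Lemma split_map_nat n (J : {set 'I_n}) (i : nat) :
  exists M : nat, split_map J i%:R = M%:R :> R.
Proof.
exists (i + \sum_(j in J) (j < i))%N; rewrite natrD natr_sum; congr (_ + _).
apply: eq_bigr => j _; rewrite -/(clamp _).
case: ltnP => ij /=.
  have : (1 : R) <= i%:R - j%:R by rewrite lerBrDr nat1r ler_nat.
  by case: clampP => ?; lra.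
have : (i%:R : R) - j%:R <= 0 by rewrite subr_le0 ler_nat.
by case: clampP => ?; lra.
Qed.

Lemma exp2R_gt0 (e : nat) : 0 < 2 ^+ e :> R.
Proof. by rewrite exprn_gt0. Qed.

Lemma nat_lt_div (c e M : nat) : (c%:R / 2 ^+ e < M%:R :> R) = (c < M * 2 ^ e)%N.
Proof. by rewrite ltr_pdivrMr ?exp2R_gt0// -natrX -natrM ltr_nat. Qed.

Lemma nat_le_div (c e M : nat) : (M%:R <= c%:R / 2 ^+ e :> R) = (M * 2 ^ e <= c)%N.
Proof. by rewrite ler_pdivlMr ?exp2R_gt0// -natrX -natrM ler_nat. Qed.

Lemma nat_div_le (c e M : nat) : (c%:R / 2 ^+ e <= M%:R :> R) = (c <= M * 2 ^ e)%N.
Proof. by rewrite ler_pdivrMr ?exp2R_gt0// -natrX -natrM ler_nat. Qed.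

Lemma unit_itvE (c e : nat) (t : R) : 0 <= t <= 1 ->
  c%:R / 2 ^+ e <= (c%:R + t) / 2 ^+ e <= c.+1%:R / 2 ^+ e.
Proof.
by move=> ?; rewrite !ler_pM2r ?invr_gt0 ?exp2R_gt0// -natr1; lra.
Qed.

(** The interval $[c/2^e, (c+1)/2^e]$ has no integer in its interior, so it lies in the image of one
    unit interval [j, j + 1], where the splitting is affine of slope 1 or 2 and can be undone. *)
Lemma below_split_map n (J : {set 'I_n}) gam :
  (forall t, 0 <= t <= 1 -> 0 <= gam t <= n%:R) ->
  below (split_map J \o gam) -> below gam.
Proof.
move=> gam_n [c [e sE]]; have P := exp2R_gt0 e.
have z0 : 0 <= (0 : R) <= 1 by rewrite lexx ler01.
have z1 : 0 <= (1 : R) <= 1 by rewrite lexx ler01.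
have lt01 : gam 0 < gam 1.
  rewrite -(leW_mono (split_map_mono J)) [_ _ (gam 0)]sE// [_ _ (gam 1)]sE//.
  by rewrite ltr_pM2r ?invr_gt0//; lra.
pose j := Num.truncn (gam 0).
have /andP[g0 _] := gam_n _ z0; have /andP[_ g1n] := gam_n _ z1.
have /andP[j0 j1] := truncn_itv g0; rewrite -/j in j0 j1.
have jn : (j < n)%N by rewrite -(ltr_nat R); apply: le_lt_trans j0 (lt_le_trans lt01 g1n).
have [M ME] := split_map_nat J j.
have slope (x : R) : j%:R <= x <= j.+1%:R ->
    split_map J x = M%:R + (if Ordinal jn \in J then 2 else 1) * (x - j%:R).
  by move=> h; rewrite (split_map_slope J (i := Ordinal jn) h) /= ME.
have [M' M'E] := split_map_nat J j.+1.
have lo : (M * 2 ^ e <= c)%N.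
  by rewrite -nat_le_div; have := sE _ z0; rewrite addr0 /= => <-; rewrite -ME split_map_mono.
have hi : (c < M' * 2 ^ e)%N.
  rewrite -nat_lt_div; have := sE _ z0; rewrite addr0 /= => <-.
  by rewrite -M'E (leW_mono (split_map_mono J)).
have gj t : 0 <= t <= 1 -> j%:R <= gam t <= j.+1%:R.
  move=> t01; have /andP[a b] := unit_itvE c e t01.
  rewrite -(split_map_mono J j%:R) -(split_map_mono J (gam t)) ME M'E [split_map J (gam t)]sE//.
  by rewrite (le_trans _ a) ?nat_le_div// (le_trans b)// nat_div_le.
(* Undoing a split of the interval j halves lengths, so the exponent grows by one. *)
pose d := if Ordinal jn \in J then 1%N else 0%N.
exists (j * 2 ^ (e + d) + (c - M * 2 ^ e))%N, (e + d)%N => t t01.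
have := slope _ (gj _ t01); rewrite [split_map J (gam t)]sE//.
rewrite natrD natrM natrX natrB// natrM natrX exprD /d.
have Pn : 2 ^+ e != 0 :> R by rewrite gt_eqF.
case: ifP => _ h.
  have -> : gam t = j%:R + ((c%:R + t) / 2 ^+ e - M%:R) / 2 by rewrite h; lra.
  by rewrite expr1; field.
have -> : gam t = j%:R + ((c%:R + t) / 2 ^+ e - M%:R) by rewrite h; lra.
by rewrite expr0; field.
Qed.

(** Let $c = j2^e + q$ with $q < 2^e$. If j is not in J, the interval is translated; if j is in J
    and $e > 0$, e drops by one. Only for j in J and $e = 0$, when [gam] is the piece j, is the
    hyperplane crossed. *)
Lemma below_split_mapE n (J : {set 'I_n}) gam :
  (forall t, 0 <= t <= 1 -> 0 <= gam t <= n%:R) ->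
  `[< below (split_map J \o gam) >]%:R =
    `[< below gam >]%:R - \sum_(j in J) `[< piece gam j >]%:R :> R.
Proof.
move=> gam_n.
have z0 : 0 <= (0 : R) <= 1 by rewrite lexx ler01.
have z1 : 0 <= (1 : R) <= 1 by rewrite lexx ler01.
case: (asboolP (below gam)) => [[c [e gE]]|ngam]; last first.
  rewrite asboolF; last by move/(below_split_map gam_n).
  by rewrite big1 ?subr0// => j _; rewrite asboolF// => /piece_below.
have P := exp2R_gt0 e; have P' := expn_gt0 2 e.
have Pn : 2 ^+ e != 0 :> R by rewrite gt_eqF.
have cn : (c < n * 2 ^ e)%N.
  rewrite -nat_lt_div; have /andP[_] := gam_n _ z1; rewrite gE//; apply: lt_le_trans.
  by rewrite ltr_pM2r ?invr_gt0//; lra.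
pose j := (c %/ 2 ^ e)%N; pose q := (c %% 2 ^ e)%N.
have jn : (j < n)%N by rewrite ltn_divLR.
have cE : c%:R = j%:R * 2 ^+ e + q%:R :> R.
  by rewrite {1}(divn_eq c (2 ^ e)) natrD natrM natrX.
have gj t : 0 <= t <= 1 -> j%:R <= gam t <= j.+1%:R.
  move=> t01; have /andP[a b] := unit_itvE c e t01; rewrite gE//.
  rewrite (le_trans _ a) ?nat_le_div ?leq_trunc_div// (le_trans b)// nat_div_le.
  by rewrite -ltn_divLR.
have [M ME] := split_map_nat J j.
have slope t : 0 <= t <= 1 ->
    split_map J (gam t) = M%:R + (if Ordinal jn \in J then 2 else 1) * ((q%:R + t) / 2 ^+ e).
  move=> t01; rewrite -ME (split_map_slope J (i := Ordinal jn)) ?gj//= gE// cE.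
  by congr (_ + _ * _); field.
have pieceE (i : 'I_n) : piece gam i -> i = Ordinal jn /\ e = 0%N.
  move=> gi; have := gi _ z0; have := gi _ z1; rewrite !gE// => h1 h0.
  have e0 : e = 0%N.
    have /eqP : 2 ^+ e = 1 :> R.
      have : 1 / 2 ^+ e = 1 :> R by lra.
      by move/(canRL (divfK Pn)); rewrite mul1r.
    by rewrite -natrX pnatr_eq1 -[1%N](expn0 2) eqn_exp2l// => /eqP.
  split=> //; apply: val_inj => /=; rewrite /j e0 expn0 divn1.
  by move: h0; rewrite e0 expr0 divr1 !addr0 => /eqP; rewrite eqr_nat => /eqP.
have [jJ|jJ] := boolP (Ordinal jn \in J); last first.
  rewrite big1 ?subr0 => [|i iJ]; last first.
    by rewrite asboolF// => /pieceE[ij _]; rewrite ij (negbTE jJ) in iJ.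
  rewrite asboolT//; exists (M * 2 ^ e + q)%N, e => t t01 /=.
  by rewrite slope// (negbTE jJ) natrD natrM natrX; field.
case: (posnP e) => [e0|e_gt0].
  rewrite (bigD1 (Ordinal jn))//= big1 => [|i /andP[_ ij]]; last first.
    by rewrite asboolF// => /pieceE[/eqP]; rewrite (negbTE ij).
  rewrite addr0 (asboolT (P := piece _ _)) => [|t t01]; last first.
    by rewrite gE// /j e0 expn0 divn1 expr0 divr1.
  (* After the split the slope is 2, which is not of the form $1/2^{e'}$. *)
  rewrite subrr asboolF// => -[c' [e' h]].
  have := h _ z0; have := h _ z1; rewrite /= !slope// jJ e0 expr0 => h1 h0.
  have : 1 / 2 ^+ e' = 2 :> R by lra.
  have : 1 / 2 ^+ e' <= 1 :> R.
    by rewrite ler_pdivrMr ?exp2R_gt0// mul1r exprn_ege1// ler1n.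
  lra.
rewrite big1 ?subr0 => [|i iJ]; last first.
  by rewrite asboolF// => /pieceE[_ e0]; rewrite e0 in e_gt0.
rewrite asboolT//; exists (M * 2 ^ e.-1 + q)%N, e.-1 => t t01 /=.
rewrite slope// jJ -[e in LHS](prednK e_gt0) exprS natrD natrM natrX.
by field; rewrite gt_eqF ?exp2R_gt0.
Qed.

(* The affine function on each cube that is 1 at the vertices below the
   hyperplane psi and 0 at the others. *)
Definition height psi (p : cube_point R) : R :=
  `[< below (clabel p \o psi) >]%:R -
    \sum_j cpos p 0 j * `[< piece (clabel p \o psi) j >]%:R.

(** The vertex A settles the constant, and adding a single j of B outside A gives [w j = 0]; all
    other coordinates are fixed on the face. *)
Lemma affine_face0 n (A B : {set 'I_n}) (a : R) (w : 'I_n -> R) : A \subset B ->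
  (forall J : {set 'I_n}, A \subset J /\ J \subset B ->
     a + \sum_j chi R J 0 j * w j = 0) ->
  forall x, face A B x -> a + \sum_j x 0 j * w j = 0.
Proof.
move=> AB vert x xf.
have chiE (J : {set 'I_n}) : \sum_j chi R J 0 j * w j = \sum_(j in J) w j.
  rewrite [RHS]big_mkcond; apply: eq_bigr => j _; rewrite mxE.
  by case: ifP; rewrite ?mul1r ?mul0r.
have vA := vert A (conj (subxx _) AB); rewrite chiE in vA.
have wB j : j \in B -> j \notin A -> w j = 0.
  move=> jB jA; have /vert : A \subset j |: A /\ j |: A \subset B.
    by rewrite finset.subsetUr finset.subUset finset.sub1set jB.
  by rewrite chiE big_setU1//= addrCA vA addr0.
rewrite -[RHS]vA; congr (_ + _); rewrite [RHS]big_mkcond; apply: eq_bigr => j _.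
have [_ x1 x0] := xf j; case: ifP => jA; first by rewrite x1// mul1r.
have [jB|jB] := boolP (j \in B); last by rewrite x0// mul0r.
by rewrite wB ?jA// mulr0.
Qed.

Lemma thompson_itv n g x : thompson n g -> 0 <= x <= 1 -> 0 <= g x <= n%:R.
Proof.
by move=> [_ [h [gn _ _ _ _]] _] x01; have := gn x; rewrite /= !in_itv /= => /(_ x01).
Qed.

Lemma thompson_inj n g x y : thompson n g -> 0 <= x <= 1 -> 0 <= y <= 1 ->
  g x = g y -> x = y.
Proof.
move=> [_ [h [_ _ gK _ _]] _] x01 y01 e; rewrite -(gK x) ?e ?gK//.
  by rewrite inE /= in_itv.
by rewrite inE /= in_itv.
Qed.

(** By [below_split_mapE] the height at a vertex depends only on the label of that vertex, and an
    affine function on a face is determined by its values at the vertices. *)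
Lemma height_glued psi p q : (forall t, 0 <= t <= 1 -> 0 <= psi t <= 1) ->
  glued p q -> height psi p = height psi q.
Proof.
move=> psi01 [A [B [A' [B' [M [b [[AB _] vert _ xp xq]]]]]]].
have gam_n (p' : cube_point R) t : 0 <= t <= 1 ->
    0 <= (clabel p' \o psi) t <= (cdim p')%:R.
  by move=> /psi01; exact: thompson_itv (clabelP p').
have labelE (p' : cube_point R) (J : {set 'I_(cdim p')}) :
    `[< below (split_label (clabel p') J \o psi) >]%:R =
    `[< below (clabel p' \o psi) >]%:R -
     \sum_j chi R J 0 j * `[< piece (clabel p' \o psi) j >]%:R.
  rewrite [LHS](below_split_mapE J (gam_n p')); congr (_ - _).
  rewrite [LHS]big_mkcond; apply: eq_bigr => j _; rewrite mxE.
  by case: ifP; rewrite ?mul1r ?mul0r.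
pose w (p' : cube_point R) j : R := `[< piece (clabel p' \o psi) j >]%:R.
pose u i := \sum_j M i j * w q j.
have pull (x : 'rV[R]_(cdim p)) : \sum_j (x *m M + b) 0 j * w q j =
    \sum_i x 0 i * u i + \sum_j b 0 j * w q j.
  rewrite [X in _ = X + _](eq_bigr (fun i => \sum_j x 0 i * M i j * w q j)).
    rewrite exchange_big -big_split; apply: eq_bigr => j _.
    by rewrite !mxE mulrDl mulr_suml.
  by move=> i _; rewrite mulr_sumr; apply: eq_bigr => j _; rewrite mulrA.
(* The constant term of the difference of the two heights, as an affine function of the position in
   the first cube. *)
pose a : R := `[< below (clabel p \o psi) >]%:R -
  `[< below (clabel q \o psi) >]%:R + \sum_j b 0 j * w q j.
have E (x : 'rV[R]_(cdim p)) : `[< below (clabel p \o psi) >]%:R - \sum_j x 0 j * w p j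
    - (`[< below (clabel q \o psi) >]%:R - \sum_j (x *m M + b) 0 j * w q j)
    = a + \sum_j x 0 j * (u j - w p j).
  rewrite pull /a.
  rewrite [X in _ = _ + X](_ : _ = \sum_j x 0 j * u j - \sum_j x 0 j * w p j); first ring.
  by rewrite -sumrB; apply: eq_bigr => j _; rewrite mulrBr.
apply/eqP; rewrite -subr_eq0 /height xq; apply/eqP; rewrite [LHS]E.
apply: (affine_face0 AB) xp => J AJB; rewrite -E.
have [J' [_ -> e]] := vert J AJB.
by rewrite /w -!labelE e subrr.
Qed.

Lemma height_eq psi p q : (forall t, 0 <= t <= 1 -> 0 <= psi t <= 1) ->
  to_X p = to_X q -> height psi p = height psi q.
Proof.
move=> psi01 /eqmodP/asboolP.
elim=> [x y|//|x y _ ->//|x y z _ -> _ ->//]; exact: height_glued.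
Qed.

Definition X_height psi (P : X R) : R := height psi (repr P).

Lemma X_heightE psi p : (forall t, 0 <= t <= 1 -> 0 <= psi t <= 1) ->
  X_height psi (to_X p) = height psi p.
Proof. by move=> psi01; apply: height_eq => //; rewrite /to_X reprK. Qed.

End Hyperplanes.

(** * The lower bound *)

Section SumsOfSquares.
Variable R : realType.

Lemma sum_sqr_ge0 (I : finType) (a : I -> R) : 0 <= \sum_i a i ^+ 2.
Proof. by apply: sumr_ge0 => i _; exact: sqr_ge0. Qed.

Lemma sum_sqr_le0 (I : finType) (a : I -> R) : \sum_i a i ^+ 2 <= 0 -> forall i, a i = 0.
Proof.
move=> a0 i; apply/eqP; rewrite -sqrf_eq0 eq_le sqr_ge0 andbT (le_trans _ a0)//.
by rewrite (bigD1 i)//= lerDl sumr_ge0// => j _; exact: sqr_ge0.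
Qed.

(** Expand $\sum_i (Ba_i - Ab_i)^2 \ge 0$ and cancel $AB$, after the cases where A or B is 0. *)
Lemma cauchy_schwarz_le (I : finType) (a b : I -> R) (A B : R) : 0 <= A -> 0 <= B ->
  \sum_i a i ^+ 2 <= A ^+ 2 -> \sum_i b i ^+ 2 <= B ^+ 2 -> \sum_i a i * b i <= A * B.
Proof.
move=> A0 B0 aA bB.
have [AE|An] := eqVneq A 0.
  rewrite AE mul0r big1// => i _; rewrite (sum_sqr_le0 (a := a)) ?mul0r//.
  by rewrite (le_trans aA)// AE expr0n.
have [BE|Bn] := eqVneq B 0.
  rewrite BE mulr0 big1// => i _; rewrite (sum_sqr_le0 (a := b)) ?mulr0//.
  by rewrite (le_trans bB)// BE expr0n.
have AB : 0 < A * B by rewrite mulr_gt0 ?lt_def ?An ?Bn.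
have := sum_sqr_ge0 (fun i => B * a i - A * b i).
have -> : \sum_i (B * a i - A * b i) ^+ 2 =
    B ^+ 2 * (\sum_i a i ^+ 2) + A ^+ 2 * (\sum_i b i ^+ 2)
    - 2 * (A * B) * \sum_i a i * b i.
  rewrite !mulr_sumr -big_split -sumrB; apply: eq_bigr => i _ /=; ring.
have := ler_wpM2l (sqr_ge0 B) aA; have := ler_wpM2l (sqr_ge0 A) bB.
move: (\sum_i a i ^+ 2) (\sum_i b i ^+ 2) (\sum_i a i * b i) => sa sb s h1 h2 h3.
rewrite -(ler_pM2l AB); nra.
Qed.

(** Each inner double sum has at most one nonzero term, and no [z j] serves two values of e. *)
Lemma sum_sqr_partial_matching (I L J : finType) (P : I -> L -> J -> bool) (z : J -> R) :
  (forall e l l' j j', P e l j -> P e l' j' -> l = l' /\ j = j') ->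
  (forall e e' l l' j, P e l j -> P e' l' j -> e = e' /\ l = l') ->
  \sum_e (\sum_l \sum_j z j * (P e l j)%:R) ^+ 2 <= \sum_j z j ^+ 2.
Proof.
move=> row col.
have rowE e : (\sum_l \sum_j z j * (P e l j)%:R) ^+ 2 =
    \sum_l \sum_j z j ^+ 2 * (P e l j)%:R.
  rewrite !pair_big /=.
  have [[l j] /= Plj|none] := pickP (fun p : L * J => P e p.1 p.2); last first.
    by rewrite !big1 ?expr0n//= => p _; rewrite (none p) mulr0.
  have others p : p != (l, j) -> P e p.1 p.2 = false.
    by apply: contraNF => /(row _ _ _ _ _ Plj)[-> ->]; case: p.
  rewrite (bigD1 (l, j))//= [RHS](bigD1 (l, j))//= Plj !mulr1.
  by rewrite !big1 ?addr0// => p /others ->; rewrite mulr0.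
under eq_bigr => e _ do rewrite rowE exchange_big.
rewrite exchange_big; apply: ler_sum => j _ /=; rewrite pair_big /=.
have [[e l] /= Pel|none] := pickP (fun p : I * L => P p.1 p.2 j); last first.
  by rewrite big1 ?sqr_ge0//= => p _; rewrite (none p) mulr0.
rewrite (bigD1 (e, l))//= Pel mulr1 big1 ?addr0// => p ne.
case: (boolP (P p.1 p.2 j)) => [/(col _ _ _ _ _ Pel)[ee ll]|]; last by rewrite mulr0.
by rewrite ee ll -surjective_pairing eqxx in ne.
Qed.

End SumsOfSquares.

(** * The hyperplanes that meet the flat *)

Section FlatHyperplanes.
Variables (R : realType) (r : nat).
Let N := (2 ^ r)%N.
Implicit Types (i : 'I_N) (b : bool) (l : int) (t : R).

(* Inverse of the piece pair_ord i b of flat_label k, for any k with k i = l. *)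
Definition flat_piece i b l t : R :=
  (i%:R + rho_pow l ((t + b%:R) / 2)) / N%:R.

Lemma half_itv b t : 0 <= t <= 1 -> 0 <= (t + b%:R) / 2 <= 1.
Proof. by case: b => ? /=; lra. Qed.

Lemma flat_pieceK i b l t :
  N%:R * flat_piece i b l t = i%:R + rho_pow l ((t + b%:R) / 2).
Proof. by rewrite /flat_piece mulrCA divff ?mulr1// gt_eqF// N_gt0. Qed.

Lemma flat_piece_itv i b l t : 0 <= t <= 1 ->
  i%:R <= N%:R * flat_piece i b l t <= i.+1%:R.
Proof.
by move=> /(half_itv b)/(rho_pow01 l); rewrite flat_pieceK -natr1; lra.
Qed.

Lemma flat_piece01 i b l t : 0 <= t <= 1 -> 0 <= flat_piece i b l t <= 1.
Proof.
move=> /(flat_piece_itv i b l) /andP[h1 h2]; have N0 := N_gt0 R r.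
rewrite -(pmulr_rge0 _ N0) (le_trans _ h1)//=.
rewrite -(ler_pM2l N0) mulr1 (le_trans h2)// ler_nat; exact: ltn_ord.
Qed.

Lemma natD_inj (p q : nat) (x y : R) : 0 <= x < 1 -> 0 <= y < 1 ->
  p%:R + x = q%:R + y -> p = q /\ x = y.
Proof.
move=> x01 y01 e; suff pq : p = q by split=> //; move: e; rewrite pq => /addrI.
apply/eqP; rewrite eqn_leq; apply/andP.
by split; rewrite -ltnS -(ltr_nat R) -natr1; lra.
Qed.

(** At t = 0, the integer part of N times the value gives i, and the vanishing of its fractional
    part decides b. Then l is read off from the orbit of 1/2, at t = 0 if b is true and at t = 1
    otherwise. *)
Lemma flat_piece_inj i i' b b' l l' :
  (forall t, 0 <= t <= 1 -> flat_piece i b l t = flat_piece i' b' l' t) ->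
  [/\ i = i', b = b' & l = l'].
Proof.
have N0 : (N%:R : R) != 0 by rewrite gt_eqF ?N_gt0.
move=> H; have E t : 0 <= t <= 1 -> i%:R + rho_pow l ((t + b%:R) / 2) =
    i'%:R + rho_pow l' ((t + b'%:R) / 2).
  by move=> /H /(divIf N0).
have h := rho_pow_half_itv R l; have h' := rho_pow_half_itv R l'.
have inj : rho_pow l (1 / 2 : R) = rho_pow l' (1 / 2) -> l = l'.
  by move=> e; apply: le_anti; rewrite -!(rho_pow_half_mono R) e lexx.
have frac (a : int) (d : bool) : 0 <= rho_pow a (d%:R / 2 : R) < 1.
  have := rho_pow_half_itv R a; case: d => /=; first by case/andP => /ltW ->.
  by rewrite mul0r rho_pow0 lexx ltr01.
have e : i%:R + rho_pow l (b%:R / 2) = i'%:R + rho_pow l' (b'%:R / 2) :> R.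
  by have := E 0; rewrite !add0r lexx ler01 => /(_ isT).
have [/val_inj ii e0] := natD_inj (frac l b) (frac l' b') e; subst i'.
have := E 1; rewrite lexx ler01 => /(_ isT) e1.
case: b b' e0 e1 {H E e} => [] [] /=; rewrite ?mul0r ?rho_pow0 => e0 e1.
- by split=> //; exact: inj.
- lra.
- lra.
- by split=> //; apply: inj; move: e1; rewrite !addr0; lra.
Qed.

Lemma piece_col n (g : R -> R) (j : nat) i i' b b' l l' : thompson n g ->
  piece (g \o flat_piece i b l) j -> piece (g \o flat_piece i' b' l') j ->
  [/\ i = i', b = b' & l = l'].
Proof.
move=> gn p p'; apply: flat_piece_inj => t t01.
by apply: (thompson_inj gn); rewrite ?flat_piece01// -![g _]/((g \o _) t) p// p'.
Qed.

(** All hyperplanes of the family (i, b) share an endpoint, the image of t = b: it is i/N or (i +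
    1)/N. The value of g there determines j. *)
Lemma piece_row n (g : R -> R) (j j' : nat) i b l l' : thompson n g ->
  piece (g \o flat_piece i b l) j -> piece (g \o flat_piece i b l') j' -> j = j'.
Proof.
move=> gn p p'.
have z0 : 0 <= (0 : R) <= 1 by rewrite lexx ler01.
have z1 : 0 <= (1 : R) <= 1 by rewrite lexx ler01.
have : b%:R + j%:R = b%:R + j'%:R :> R.
  case: b p p' => p p'.
    have := p _ z1; have := p' _ z1; rewrite /= /flat_piece -[1 + _]/2 divff ?pnatr_eq0//.
    by rewrite !rho_pow1 => -> e; rewrite addrC -e addrC.
  have := p _ z0; have := p' _ z0; rewrite /= /flat_piece addr0 mul0r !rho_pow0.
  by move=> -> e; rewrite !add0r; move: e; rewrite !addr0.
by move=> /addrI/eqP; rewrite eqr_nat => /eqP.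
Qed.

Lemma flat_label_piece (k : 'I_N -> int) i b l t : 0 <= t <= 1 ->
  (flat_label k \o flat_piece i b l) t =
  i.*2%:R + 2 * rho_pow (l - k i) ((t + b%:R) / 2).
Proof.
move=> t01; rewrite /= /flat_label in_itv /= flat_piece01//.
rewrite (flat_fun_itv _ (flat_piece_itv i b l t01)).
rewrite flat_pieceK addrAC subrr add0r /block clamp_id ?rho_pow01 ?half_itv//.
by rewrite -rho_powD [l - _]addrC.
Qed.

(** An interval of length $1/2^e$ has length at most 1, which bounds $\rho^{l-k_i}(1/2)$ on one side
    of 1/2 and so compares l with [k i]. Conversely, [rho_pow_right] and [rho_pow_left] give c and e
    explicitly. *)
Lemma flat_label_below (k : 'I_N -> int) i b l :
  below (flat_label k \o flat_piece i b l : R -> R) <-> (if b then k i <= l else l <= k i).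
Proof.
have z0 : 0 <= (0 : R) <= 1 by rewrite lexx ler01.
have z1 : 0 <= (1 : R) <= 1 by rewrite lexx ler01.
have le1 (e : nat) : 1 / 2 ^+ e <= 1 :> R.
  by rewrite ler_pdivrMr ?exp2R_gt0// mul1r exprn_ege1// ler1n.
split=> [[c [e h]]|].
  have := h _ z0; have := h _ z1; have := le1 e; rewrite !flat_label_piece//.
  have mono a a' := rho_pow_half_mono R a a'.
  case: b {h} => /=.
    rewrite -[1 + 1]/2 divff ?pnatr_eq0// rho_pow1 add0r => h1 h2 h3.
    rewrite -subr_ge0 -(mono 0 (l - k i)) /=; lra.
  rewrite !addr0 mul0r rho_pow0 => h1 h2 h3.
  rewrite -subr_le0 -(mono (l - k i) 0) /=; lra.
case: b => kl.
  have [d dE] : exists d : nat, l - k i = d by exists (absz (l - k i)); lia.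
  exists ((i.*2 + 2) * 2 ^ d - 1)%N, d => t t01; rewrite flat_label_piece// dE.
  rewrite (_ : (t + _) / 2 = 1 - (1 - t) / 2); last by rewrite /=; lra.
  rewrite rho_pow_right; last lra.
  rewrite natrB ?muln_gt0 ?addn_gt0 ?orbT ?expn_gt0// natrM natrD natrX exprS.
  by field; rewrite gt_eqF ?exp2R_gt0.
have [d dE] : exists d : nat, l - k i = - d%:Z by exists (absz (l - k i)); lia.
exists (i.*2 * 2 ^ d)%N, d => t t01; rewrite flat_label_piece// dE.
rewrite addr0 rho_pow_left// natrM natrX exprS.
by field; rewrite gt_eqF ?exp2R_gt0.
Qed.

Lemma flat_label_pieceE (k : 'I_N -> int) i b l (j : 'I_N.*2) :
  piece (flat_label k \o flat_piece i b l : R -> R) j <-> l = k i /\ j = pair_ord i b.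
Proof.
have z0 : 0 <= (0 : R) <= 1 by rewrite lexx ler01.
have z1 : 0 <= (1 : R) <= 1 by rewrite lexx ler01.
have P : piece (flat_label k \o flat_piece i b (k i) : R -> R) (pair_ord i b).
  by move=> t t01; rewrite flat_label_piece// subrr /= natrD; lra.
split=> [p|[-> ->]//].
have jE := piece_row (flat_label_thompson R k) P p.
move: (p); rewrite -jE => /(piece_col (flat_label_thompson R k) P)[_ _ ->].
by split=> //; apply/val_inj/esym.
Qed.

Lemma height_flat (k : 'I_N -> int) (c : 'I_N -> R) (kc : incell k c) i b l :
  height (flat_piece i b l) (flat_cube_point kc) =
  (if b then k i <= l else l <= k i)%:R - flat_pos k c 0 (pair_ord i b) * (l == k i)%:R.
Proof.
rewrite /height /=; congr (_ - _).
  by congr (_%:R); congr nat_of_bool; apply/asboolP/idP => /flat_label_below.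
rewrite (bigD1 (pair_ord i b))//= big1 ?addr0 => [|j jib].
  congr (_ * _%:R); congr nat_of_bool.
  have [to from] := flat_label_pieceE k i b l (pair_ord i b).
  by apply/asboolP/eqP => [/to[]//|?]; exact: from.
by rewrite asboolF ?mulr0// => /flat_label_pieceE[_ /eqP]; rewrite (negbTE jib).
Qed.

Variable n : nat.

(** A family has one hyperplane for each integer; the window from -n to n - 1 keeps the sums
    finite. *)
Definition level (q : 'I_n.*2) : int := q%:Z - n%:Z.

Definition flat_height i b (P : X R) : R := \sum_q X_height (flat_piece i b (level q)) P.

(** Inside a cube the change of heights is linear in [x - y], with coefficients the indicators of
    [piece]; [piece_row] and [piece_col] make these a partial matching. *)
Lemma flat_height_contract (P Q : X R) d : cube_dist P Q d ->
  0 <= d /\ \sum_(e : 'I_N * bool) (flat_height e.1 e.2 P - flat_height e.1 e.2 Q) ^+ 2 <= d ^+ 2.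
Proof.
move=> [m [g [m_gt0 [gm [x [y [x01 [y01 [-> -> ->]]]]]]]]].
split; first exact: sqrtr_ge0.
rewrite sqr_sqrtr ?sum_sqr_ge0//.
pose P' (e : 'I_N * bool) (q : 'I_n.*2) (j : 'I_m) : bool :=
  `[< piece (g \o flat_piece e.1 e.2 (level q)) j >].
rewrite (eq_bigr (fun e => (\sum_q \sum_j (x - y) 0 j * (P' e q j)%:R) ^+ 2)).
  apply: sum_sqr_partial_matching.
    move=> e q q' j j' /asboolP p /asboolP p'.
    have jj := piece_row gm p p'; rewrite -jj in p'; split; last exact: val_inj.
    have [_ _] := piece_col gm p p'; rewrite /level => /addIr[]; exact: val_inj.
  move=> [i b] [i' b'] q q' j /asboolP p /asboolP p'.
  have [/= -> ->] := piece_col gm p p'; rewrite /level => /addIr[] ?.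
  by split=> //; exact: val_inj.
move=> [i b] _ /=; rewrite /flat_height -sumrB -[RHS]sqrrN -sumrN; congr (_ ^+ 2).
apply: eq_bigr => q _; rewrite !X_heightE; try exact: flat_piece01.
pose S (v : 'rV[R]_m) := \sum_j v 0 j * (P' (i, b) q j)%:R.
rewrite /height (_ : _ - _ = S y - S x); last by rewrite /S /P' /=; ring.
rewrite /S -sumrB -sumrN; apply: eq_bigr => j _.
by rewrite !mxE; ring.
Qed.

(** With $p = k_i + n$, the label is below 2n - p members of the window if b is true and p + 1 if it
    is false. Subtracting the coordinate in the cube turns this count into an affine function of
    [c i], independent of the cell. *)
Lemma flat_height_flat (k : 'I_N -> int) (c : 'I_N -> R) (kc : incell k c) i b :
  (`|k i| < n)%N ->
  flat_height i b (flat_point kc) = n%:R + if b then - c i else c i.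
Proof.
move=> kn; rewrite /flat_height.
have [p pE] : exists p : nat, k i + n%:Z = p by exists (absz (k i + n%:Z)); lia.
have pn : (p < n.*2)%N by lia.
have kE : (k i)%:~R = p%:R - n%:R :> R by rewrite -[k i](addrK n%:Z) pE rmorphB.
under eq_bigr => q _.
  rewrite X_heightE; last exact: flat_piece01.
  rewrite height_flat; over.
rewrite sumrB -mulr_sumr.
have -> : \sum_q (level q == k i)%:R = 1 :> R.
  rewrite (bigD1 (Ordinal pn))//= big1 ?addr0 => [|q qp].
    by rewrite (_ : _ == _)//; apply/eqP; rewrite /level /=; lia.
  rewrite (_ : (_ == _) = false)//; apply: contraNF qp => /eqP.
  by rewrite /level -val_eqE /= => ?; apply/eqP; lia.
rewrite mulr1 flat_posE kE; case: b.
  have -> : \sum_q (k i <= level q)%R%:R = n.*2%:R - p%:R :> R.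
    rewrite -(sum_ltn R (ltnW pn)) -[X in X%:R - _]card_ord -sumr_const -sumrB.
    apply: eq_bigr => q _; rewrite (_ : (_ <= _)%R = (p <= q)%N); last first.
      by rewrite /level; lia.
    by case: ltnP; rewrite ?subr0 ?subrr.
  by rewrite -addnn natrD; ring.
have -> : \sum_q (level q <= k i)%R%:R = p.+1%:R :> R.
  rewrite -(sum_ltn R pn); apply: eq_bigr => q _; congr (_%:R); congr nat_of_bool.
  by rewrite /level; lia.
rewrite -natr1; ring.
Qed.

End FlatHyperplanes.

(** * The distance on the flat *)

Section LowerBound.
Variables (R : realType) (r : nat).
Let N := (2 ^ r)%N.

(** Let w be the difference of the height vectors of the two ends, of norm [flat_dist c c']. By
    Cauchy-Schwarz, the inner product F with w falls by at most $|w| d_q$ at each step, while its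
    total fall is $|w|^2$. *)
Lemma stringed_flat_ge (k l : 'I_N -> int) (c c' : 'I_N -> R)
    (kc : incell k c) (lc : incell l c') (L : R) :
  stringed (flat_point kc) (flat_point lc) L -> flat_dist c c' <= L.
Proof.
move=> [K [z [d [z0 zK zd ->]]]].
have d0 q : (q < K)%N -> 0 <= d q.
  (* Only the sign of the length is wanted here, so the empty window suffices. *)
  by move=> /zd /(@flat_height_contract R r 0)[].
(* A window large enough for all coordinates of both cells. *)
pose n := (\sum_i (`|k i| + `|l i|)).+1%N.
have kn i : (`|k i| < n)%N by rewrite ltnS (bigD1 i)//= -addnA leq_addr.
have ln i : (`|l i| < n)%N by rewrite ltnS (bigD1 i)//= addnAC leq_addl.
pose w (e : 'I_N * bool) :=
  flat_height n e.1 e.2 (flat_point kc) - flat_height n e.1 e.2 (flat_point lc).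
have w2 : \sum_e w e ^+ 2 = flat_dist c c' ^+ 2.
  rewrite sqr_sqrtr; last by apply: sumr_ge0 => i _; rewrite mulr_ge0 ?sqr_ge0.
  rewrite -(pair_bigA _ (fun i b => w (i, b) ^+ 2)) /=; apply: eq_bigr => i _.
  by rewrite big_bool /w /= !flat_height_flat//; ring.
pose F P := \sum_(e : 'I_N * bool) w e * flat_height n e.1 e.2 P.
have step q : (q < K)%N -> F (z q) - F (z q.+1) <= flat_dist c c' * d q.
  move=> /zd /(@flat_height_contract R r n)[dq h]; rewrite /F -sumrB.
  under eq_bigr => e _ do rewrite -mulrBr.
  by apply: cauchy_schwarz_le h; rewrite ?w2// sqrtr_ge0.
have tele : F (z 0%N) - F (z K) <= flat_dist c c' * \sum_(q < K) d q.
  rewrite mulr_sumr -(big_mkord xpredT (fun q => flat_dist c c' * d q)).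
  rewrite -opprB -(telescope_sumr (fun q => F (z q)) (leq0n K)) -sumrN.
  apply: ler_sum_nat => q /andP[_ qK].
  by rewrite opprB; exact: step.
have FE : F (z 0%N) - F (z K) = flat_dist c c' ^+ 2.
  rewrite z0 zK -w2 /F -sumrB; apply: eq_bigr => e _.
  by rewrite -mulrBr expr2.
have [D0|D0] := eqVneq (flat_dist c c') 0.
  by rewrite D0; apply: sumr_ge0 => q _; exact: d0.
by move: tele; rewrite FE expr2 ler_pM2l// lt_def D0 sqrtr_ge0.
Qed.

Lemma dX_flat_point (k l : 'I_N -> int) (c c' : 'I_N -> R)
    (kc : incell k c) (lc : incell l c') :
  dX (flat_point kc) (flat_point lc) = (flat_dist c c')%:E.
Proof.
apply/le_anti/andP; split; first exact/dX_le/stringed_flat.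
by apply: le_dX => L; exact: stringed_flat_ge.
Qed.

(** The vector is padded with zeros to N coordinates; the division cancels the factor 2 in
    [flat_dist]. *)
Definition flat_coord (m : nat) (u : 'rV[R]_m) (i : 'I_N) : R :=
  (if insub (i : nat) is Some j then u 0 j else 0) / Num.sqrt 2.

Lemma flat_dist_coord m (u v : 'rV[R]_m) : (m <= N)%N ->
  flat_dist (flat_coord u) (flat_coord v) = enorm (u - v).
Proof.
move=> mN; congr Num.sqrt.
pose f (n : nat) := (if insub n is Some j then u 0 j - v 0 j else 0) ^+ 2.
rewrite (eq_bigr (fun i : 'I_N => f i)) => [|i _].
  rewrite -(big_mkord xpredT f) (big_cat_nat _ mN)//= [X in _ + X]big_nat [X in _ + X]big1.
    rewrite addr0 big_mkord; apply: eq_bigr => j _; rewrite /f valK.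
    by rewrite !mxE.
  by move=> j /andP[mj _]; rewrite /f insubF ?expr0n// ltnNge mj.
have s2 : (Num.sqrt 2 : R) ^+ 2 = 2 by rewrite sqr_sqrtr.
rewrite /flat_coord /f -mulrBl expr_div_n s2 mulrC divfK ?pnatr_eq0//.
by case: insubP => // _; rewrite subrr.
Qed.

End LowerBound.

Lemma incell_floor (R : realType) (r : nat) (c : 'I_(2 ^ r) -> R) :
  incell (fun i => Num.floor (c i)) c.
Proof. by move=> i; have := floor_itv (c i); rewrite intrD => /andP[-> /ltW ->]. Qed.

Theorem theorem2 (R : realType) (m : nat) (hm : (1 <= m)%N) :
  exists E : 'rV[R]_m -> X R,
    forall u v : 'rV[R]_m, dX (E u) (E v) = (enorm (u - v)%R)%:E.
Proof.
(* The choice r = m leaves enough blocks, since $m \le 2^m$. *)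
exists (fun u => flat_point (incell_floor (@flat_coord R m m u))) => u v.
by rewrite dX_flat_point flat_dist_coord// ltnW// ltn_expl.
Qed.
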